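(* Let $D$ be a bounded pseudoconvex domain in $\mathbb{C}^n$, $n\ge 2$, with boundary $bD$ of class $\mathscr{C}^{r,\alpha}$ for some integer $r\ge 2$ and some $0<\alpha\le 1$, and let $\delta(\mathbf{x})=\mathrm{dist}(\mathbf{x},D)-\mathrm{dist}(\mathbf{x},\mathbb{C}^n\setminus D)$ for $\mathbf{x}\in\mathbb{C}^n$. Suppose that $K(\mathbf{p},\Lambda)\ne 0$ for every point $\mathbf{p}\in bD$ and every complex line $\Lambda\subset T_{\mathbf{p}}bD$ on which the Levi form vanishes, i.e. for which $H(\mathbf{p},\Lambda)=0$. Then the domains $D_t=\{\delta<t\}$ for $t<0$ sufficiently close to $0$ are strongly pseudoconvex.
   Context: Identify $\mathbb{C}^n$ with $\mathbb{R}^{2n}$ with its Euclidean metric. For $\mathbf{p}\in bD$ let $\mathcal{Q}_{\mathbf{p}}$ denote the second fundamental form of $bD$ at $\mathbf{p}$ with respect to the inner unit normal; it equals the restriction to $T_{\mathbf{p}}bD$ of the real Hessian $\mathrm{Hess}_\rho(\mathbf{p})$ of any defining function $\rho$ of $D$ (i.e. $D=\{\rho<0\}$, $bD=\{\rho=0\}$, $d\rho\neq0$ on $bD$) with $|\nabla\rho|=1$ at $\mathbf{p}$, for example $\rho=\delta$ near $bD$. For a real $2$-plane $\Lambda\subset T_{\mathbf{p}}bD$ let $\lambda_1(\mathbf{p},\Lambda),\lambda_2(\mathbf{p},\Lambda)$ be the eigenvalues of the restricted quadratic form $\mathcal{Q}_{\mathbf{p}}|_\Lambda$; equivalently, the principal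 curvatures at $\mathbf{p}$ of the surface obtained by intersecting $bD$ with the affine real $3$-plane through $\mathbf{p}$ spanned by $\Lambda$ and the normal vector to $bD$ at $\mathbf{p}$. Set $$H(\mathbf{p},\Lambda)=\lambda_1(\mathbf{p},\Lambda)+\lambda_2(\mathbf{p},\Lambda),\qquad K(\mathbf{p},\Lambda)=\lambda_1(\mathbf{p},\Lambda)\,\lambda_2(\mathbf{p},\Lambda),$$ the sectional mean curvature and the sectional Gaussian curvature of $bD$ at $\mathbf{p}$ on $\Lambda$. If $\Lambda\subset T_{\mathbf{p}}bD$ is a complex line, $\mathbf{v}\in\Lambda$ is a unit vector, $J$ is the standard almost complex structure on $\mathbb{C}^n$ and $\rho$ is a defining function with $|\nabla\rho(\mathbf{p})|=1$, the Levi form of $bD$ at $\mathbf{p}$ on $\Lambda$ is $$(dd^c\rho)_{\mathbf{p}}(\mathbf{v},J\mathbf{v})=\Delta(\rho|_{\mathbf{p}+\Lambda})(\mathbf{p})=\mathrm{tr}_\Lambda\,\mathrm{Hess}_\rho(\mathbf{p})=H(\mathbf{p},\Lambda),$$ where $\mathrm{tr}_\Lambda$ is the trace of the restriction of the quadratic form to $\Lambda$. Pseudoconvexity of $D$ means $H(\mathbf{p},\Lambda)\ge0$ for all $\mathbf{p}\in bD$ and all complex lines $\Lambda\subset T_{\mathbf{p}}bD$ (Levi pseudoconvexity); strong pseudoconvexity means that strict inequality holds for all such $\mathbf{p}$ and $\Lambda$ (for the boundary of the domain in question). *)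

(* Defs.v *)
From HB Require Import structures.
From mathcomp Require Import all_boot all_order all_algebra.
From mathcomp Require Import all_classical all_reals all_analysis.

Set Implicit Arguments.
Unset Strict Implicit.
Unset Printing Implicit Defensive.

Import Order.TTheory GRing.Theory Num.Theory.
Import numFieldNormedType.Exports.

Local Open Scope classical_set_scope.
Local Open Scope ring_scope.

(* The library norm of 'rV[R]_m is the sup norm: it is used only through the
   topology and boundedness.  All metric notions use [dot] and [enorm]. *)
Section Euclidean.
Context {R : realType} {m : nat}.
Implicit Types (x y v : 'rV[R]_m) (f : 'rV[R]_m -> R) (A U : set 'rV[R]_m).

Definition dot x y : R := \sum_i x 0 i * y 0 i.

Definition enorm x : R := Num.sqrt (dot x x).

Definition edist_set x A : R := inf [set enorm (x - y) | y in A].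

Definition signed_dist A x : R := edist_set x A - edist_set x (~` A).

Definition is_domain A : Prop := [/\ open A, connected A & A !=set0].

Definition bd A : set 'rV[R]_m := closure A `\` interior A.

Definition basis_vec (i : 'I_m) : 'rV[R]_m := delta_mx 0 i.

Definition grad f x : 'rV[R]_m := \row_i 'D_(basis_vec i) f x.

(* [iter_partial [:: i1; ...; ik] f] is d_i1 (... (d_ik f)) *)
Definition iter_partial (s : seq 'I_m) f : 'rV[R]_m -> R :=
  foldr (fun i g x => 'D_(basis_vec i) g x) f s.

Definition Ck_on (k : nat) U f : Prop :=
  forall s : seq 'I_m, (size s <= k)%N -> forall x, U x ->
    {for x, continuous (iter_partial s f)} /\
    ((size s < k)%N -> forall i, derivable (iter_partial s f) x (basis_vec i)).

Definition locally_holder_on (a : R) U f : Prop :=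
  forall x, U x -> exists (C : R) (W : set 'rV[R]_m), nbhs x W /\
    forall y z, W y -> W z -> `|f y - f z| <= C * enorm (y - z) `^ a.

Definition Cka_on (k : nat) (a : R) U f : Prop :=
  Ck_on k U f /\
  forall s : seq 'I_m, size s = k -> locally_holder_on a U (iter_partial s f).

Definition defining_near A (p : 'rV[R]_m) U f : Prop :=
  [/\ open U, U p,
      A `&` U = [set x | f x < 0] `&` U,
      bd A `&` U = [set x | f x = 0] `&` U &
      forall x, (bd A `&` U) x -> grad f x != 0].

Definition Ck_boundary (k : nat) A : Prop :=
  forall p, bd A p -> exists U f, defining_near A p U f /\ Ck_on k U f.

Definition Cka_boundary (k : nat) (a : R) A : Prop :=
  forall p, bd A p -> exists U f, defining_near A p U f /\ Cka_on k a U f.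

Definition inner_normal f x : 'rV[R]_m := - ((enorm (grad f x))^-1 *: grad f x).

(* Second fundamental form at p of the hypersurface {f = 0}, with respect to
   the inner unit normal N of {f < 0}: II(u, v) = - <D_u N, v>.  It is only
   meaningful for u, v tangent to the hypersurface, where it depends on
   {f < 0} only and not on the defining function f, and is equal to Hess_f
   when |grad f p| = 1. *)
Definition second_form f (p u v : 'rV[R]_m) : R :=
  - dot ('D_u (inner_normal f) p) v.

Definition tangent_plane f p (L : {vspace 'rV[R]_m}) : Prop :=
  forall v, v \in L -> dot (grad f p) v = 0.

(* The eigenvalues, with multiplicity and in increasing order, of the
   restriction of the bilinear form Q to the 2-plane L. *)
Definition is_eigenvalues (Q : 'rV[R]_m -> 'rV[R]_m -> R)
    (L : {vspace 'rV[R]_m}) (l : R * R) : Prop :=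
  l.1 <= l.2 /\
  exists e1 e2, [/\ e1 \in L, e2 \in L,
    [/\ dot e1 e1 = 1, dot e2 e2 = 1 & dot e1 e2 = 0],
    forall v, v \in L -> Q e1 v = l.1 * dot e1 v &
    forall v, v \in L -> Q e2 v = l.2 * dot e2 v].

Definition principal_curvatures f p (L : {vspace 'rV[R]_m}) : R * R :=
  xget (0, 0) [set l | is_eigenvalues (second_form f p) L l].

Definition sectional_mean f p L : R :=
  (principal_curvatures f p L).1 + (principal_curvatures f p L).2.

Definition sectional_gauss f p L : R :=
  (principal_curvatures f p L).1 * (principal_curvatures f p L).2.

End Euclidean.

(* C^n is identified with R^n x R^n through z = x + iy |-> (x, y). *)
Section Complex.
Context {R : realType} {n : nat}.
Implicit Types (f : 'rV[R]_(n + n) -> R) (A U : set 'rV[R]_(n + n)).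

Definition Jmul (v : 'rV[R]_(n + n)) : 'rV[R]_(n + n) :=
  row_mx (- rsubmx v) (lsubmx v).

Definition complex_line (L : {vspace 'rV[R]_(n + n)}) : Prop :=
  \dim L = 2%N /\ forall v, v \in L -> Jmul v \in L.

(* L is a complex line tangent to bd A at p, and f is a C^2 defining function
   of A near p; the curvatures at p on L can be computed from any such f. *)
Definition complex_tangent A p f (L : {vspace 'rV[R]_(n + n)}) : Prop :=
  [/\ bd A p, exists U, defining_near A p U f /\ Ck_on 2 U f,
      complex_line L & tangent_plane f p L].

Definition pseudoconvex A : Prop :=
  Ck_boundary 2 A /\
  forall p f L, complex_tangent A p f L -> 0 <= sectional_mean f p L.

Definition strongly_pseudoconvex A : Prop :=
  Ck_boundary 2 A /\
  forall p f L, complex_tangent A p f L -> 0 < sectional_mean f p L.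

End Complex.

(* Main.v *)
Require Import Defs.
From HB Require Import structures.
From mathcomp Require Import all_boot all_order all_algebra.
From mathcomp Require Import all_classical all_reals all_analysis.
From mathcomp Require Import ring lra.

Set Implicit Arguments.
Unset Strict Implicit.
Unset Printing Implicit Defensive.

Import Order.TTheory GRing.Theory Num.Theory.
Import numFieldNormedType.Exports.

Local Open Scope classical_set_scope.
Local Open Scope ring_scope.

(** Let N be the outer unit normal of bd D, A = DN its shape operator and
    d(x) = dist(x, C^n \ D), so that D_t = {d > s} with s = - t.  A compactness
    argument gives a constant k with <N(p), y - p> >= - k |y - p|^2 for p in bD
    and y outside D; hence points at small depth have a unique foot point, the
    foot point map pi is Lipschitz, and q = pi(q) - d(q) N(pi(q)).
    Differentiating this identity gives grad d = - N o pi and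
    D pi = (1 - N^T N) (1 - d A)^-1, so d is of class C^2 and the shape
    operator of {d = s} at q is A (1 - s A)^-1.  On a complex tangent line L,
    the same for q and p = pi(q), the symmetry of A yields
      <A w, u> >= <A u, u> + (s / 2) |A w|^2    where w = (1 - s A)^-1 u.
    Summing over an orthonormal basis of L, H(q, L) >= H(p, L) >= 0, and equality
    forces A = 0 on L, whence H(p, L) = K(p, L) = 0, which is excluded.
    Connectedness of D_t comes from the retraction of D onto {d >= s} along the
    normals. *)

(** * Euclidean geometry *)

(** Since bd D is only C^2, N and the map (p, s) -> p - s N(p) are only C^1, and d must still come
    out C^2. No inverse function theorem is used. The inequalities with k make pi Lipschitz;
    comparing feet then shows that d is differentiable before anything is known about D pi; finally
    the identity for q is linearized with an error o(|q - q0|) and solved for D pi. The missing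
    derivative is regained because grad d = - N o pi is itself C^1.

    The gain in curvature is modelled on an eigenvector of A with eigenvalue l: at depth s the
    curvature is l / (1 - s l) = l + s l^2 / (1 - s l), so positive and negative curvatures both
    increase. A complex line need not be invariant under A, hence the curvatures on L at q are not
    functions of those at p. The estimate is therefore made for quadratic forms and keeps the whole
    vector A w, including its part normal to L.

    Curvatures are computed from arbitrary local defining functions, so the inequality at q must be
    proved for all of them and not only for s - d.

    The touching balls have radius 1 / (2 k); depths stay below half of it, so that curvature terms
    never absorb more than half of the leading term. *)

Section EuclideanSpace.
Context {R : realType} {m : nat}.
Implicit Types (x y z u v w : 'rV[R]_m) (c e : R).

Lemma dotC x y : dot x y = dot y x.
Proof. by apply: eq_bigr => i _; rewrite mulrC. Qed.

Lemma dotDl x y z : dot (x + y) z = dot x z + dot y z.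
Proof. by rewrite -big_split; apply: eq_bigr => i _; rewrite mxE mulrDl. Qed.

Lemma dotZl c x y : dot (c *: x) y = c * dot x y.
Proof. by rewrite mulr_sumr; apply: eq_bigr => i _; rewrite mxE mulrA. Qed.

Lemma dotNl x y : dot (- x) y = - dot x y.
Proof. by rewrite -scaleN1r dotZl mulN1r. Qed.

Lemma dotBl x y z : dot (x - y) z = dot x z - dot y z.
Proof. by rewrite dotDl dotNl. Qed.

Lemma dotDr x y z : dot x (y + z) = dot x y + dot x z.
Proof. by rewrite dotC dotDl !(dotC x). Qed.

Lemma dotZr c x y : dot x (c *: y) = c * dot x y.
Proof. by rewrite dotC dotZl dotC. Qed.

Lemma dotNr x y : dot x (- y) = - dot x y.
Proof. by rewrite dotC dotNl dotC. Qed.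

Lemma dotBr x y z : dot x (y - z) = dot x y - dot x z.
Proof. by rewrite dotDr dotNr. Qed.

Lemma dot0l x : dot 0 x = 0.
Proof. by rewrite -(scale0r 0) dotZl mul0r. Qed.

Lemma dot0r x : dot x 0 = 0.
Proof. by rewrite dotC dot0l. Qed.

Definition dotE := (dotDl, dotDr, dotZl, dotZr, dotNl, dotNr, dot0l, dot0r).

Lemma dot_ge0 x : 0 <= dot x x.
Proof. by apply: sumr_ge0 => i _; rewrite -expr2 sqr_ge0. Qed.

Lemma dot_eq0 x : (dot x x == 0) = (x == 0).
Proof.
apply/eqP/eqP => [/psumr_eq0P h|->]; last by rewrite dot0l.
apply/rowP => i; rewrite mxE; apply/eqP; rewrite -sqrf_eq0 expr2.
by rewrite h// => j _; rewrite -expr2 sqr_ge0.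
Qed.

Lemma enorm_ge0 x : 0 <= enorm x.
Proof. exact: sqrtr_ge0. Qed.

Lemma sqr_enorm x : enorm x ^+ 2 = dot x x.
Proof. by rewrite sqr_sqrtr ?dot_ge0. Qed.

Lemma enorm_eq0 x : (enorm x == 0) = (x == 0).
Proof. by rewrite -dot_eq0 -sqr_enorm sqrf_eq0. Qed.

Lemma enorm0 : enorm (0 : 'rV[R]_m) = 0.
Proof. by apply/eqP; rewrite enorm_eq0. Qed.

Lemma enorm_gt0 x : (0 < enorm x) = (x != 0).
Proof. by rewrite lt_def enorm_eq0 enorm_ge0 andbT. Qed.

Lemma enormZ c x : enorm (c *: x) = `|c| * enorm x.
Proof.
by rewrite /enorm dotZl dotZr mulrA -expr2 sqrtrM ?sqr_ge0// sqrtr_sqr.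
Qed.

Lemma enormN x : enorm (- x) = enorm x.
Proof. by rewrite -scaleN1r enormZ normrN normr1 mul1r. Qed.

Lemma enormB x y : enorm (x - y) = enorm (y - x).
Proof. by rewrite -enormN opprB. Qed.

Lemma enorm_sqr_le x c : 0 <= c -> dot x x <= c ^+ 2 -> enorm x <= c.
Proof. by move=> c0; rewrite -sqr_enorm ler_sqr ?nnegrE ?enorm_ge0. Qed.

Lemma dot_le x y : `|dot x y| <= enorm x * enorm y.
Proof.
have [->|y0] := eqVneq y 0; first by rewrite dot0r normr0 mulr_ge0 ?enorm_ge0.
have yy : 0 < dot y y by rewrite lt_def dot_eq0 y0 dot_ge0.
rewrite -ler_sqr ?nnegrE ?mulr_ge0 ?enorm_ge0// exprMn !sqr_enorm.
rewrite real_normK ?num_real//.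
(* This vector is <y, y> times the part of x orthogonal to y; one factor <y, y> of its squared
   length cancels. *)
have := dot_ge0 (dot y y *: x - dot x y *: y).
rewrite !dotE (dotC y x) => h.
have : 0 <= dot y y * (dot x x * dot y y - dot x y ^+ 2) by nra.
by rewrite pmulr_rge0// subr_ge0.
Qed.

Lemma dot_ler x y : dot x y <= enorm x * enorm y.
Proof. exact: le_trans (ler_norm _) (dot_le x y). Qed.

Lemma enormD x y : enorm (x + y) <= enorm x + enorm y.
Proof.
apply: enorm_sqr_le; first by rewrite addr_ge0 ?enorm_ge0.
rewrite !dotE (dotC y x).
have := dot_ler x y; have := sqr_enorm x; have := sqr_enorm y.
nra.
Qed.

Lemma enorm_sub_le x y : enorm x - enorm y <= enorm (x - y).
Proof. by rewrite lerBlDr -{1}(subrK y x) enormD. Qed.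

Lemma enorm_dist x y z : enorm (x - z) <= enorm (x - y) + enorm (y - z).
Proof. by apply: le_trans (enormD _ _); rewrite addrA subrK. Qed.

Lemma enorm_sum (I : Type) (r : seq I) (F : I -> 'rV[R]_m) :
  enorm (\sum_(i <- r) F i) <= \sum_(i <- r) enorm (F i).
Proof.
elim: r => [|i r IH]; rewrite ?big_nil ?big_cons ?enorm0//.
by rewrite (le_trans (enormD _ _))// lerD2l.
Qed.

Lemma dot_basis x (i : 'I_m) : dot x (basis_vec i) = x 0 i.
Proof.
rewrite /dot (bigD1 i)//= mxE !eqxx mulr1 big1 ?addr0// => j ji.
by rewrite mxE (negPf ji) andbF mulr0.
Qed.

Lemma enorm_basis (i : 'I_m) : enorm (basis_vec i : 'rV[R]_m) = 1.
Proof. by rewrite /enorm dot_basis mxE !eqxx sqrtr1. Qed.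

Lemma coord_le x (i : 'I_m) : `|x 0 i| <= enorm x.
Proof. by rewrite -dot_basis (le_trans (dot_le _ _))// enorm_basis mulr1. Qed.

Lemma row_sum_basis x : x = \sum_i x 0 i *: basis_vec i.
Proof. exact: row_sum_delta. Qed.

Lemma enorm_le_sum x : enorm x <= \sum_i `|x 0 i|.
Proof.
rewrite {1}(row_sum_basis x) (le_trans (enorm_sum _ _))//.
by apply: ler_sum => i _; rewrite enormZ enorm_basis mulr1.
Qed.

Lemma sum_coord_le x : \sum_i `|x 0 i| <= m%:R * enorm x.
Proof.
rewrite (le_trans (ler_sum _ (fun i _ => coord_le x i)))//.
by rewrite sumr_const card_ord mulr_natl.
Qed.

Lemma norm_le_enorm x : `|x| <= enorm x.
Proof.
rewrite [leLHS]/Num.Def.normr/= mx_normrE (bigmax_le _ (enorm_ge0 _))//= => -[i j] _.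
by rewrite ord1 coord_le.
Qed.

Lemma coord_le_norm x (i : 'I_m) : `|x 0 i| <= `|x|.
Proof.
rewrite [leRHS]/Num.Def.normr/= mx_normrE.
exact: (le_bigmax _ (fun k => `|x k.1 k.2|) (0, i)).
Qed.

Lemma enorm_le_norm x : enorm x <= m%:R * `|x|.
Proof.
rewrite (le_trans (enorm_le_sum x))//.
rewrite (le_trans (ler_sum _ (fun i _ => coord_le_norm x i)))//.
by rewrite sumr_const card_ord mulr_natl.
Qed.

Lemma near_enorm x e : 0 < e -> \forall y \near x, enorm (y - x) < e.
Proof.
move=> e0; have e1 : 0 < e / m.+1%:R by rewrite divr_gt0.
near=> y.
have h : `|y - x| < e / m.+1%:R.
  by rewrite distrC; near: y; apply: cvgr_dist_lt.
rewrite (le_lt_trans (enorm_le_norm _))//.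
move: h; rewrite ltr_pdivlMr// mulrC => h.
by rewrite (le_lt_trans _ h)// ler_wpM2r// ler_nat.
Unshelve. all: by end_near. Qed.

(** Bridge between the sup-norm topology and Euclidean balls: the two norms are equivalent. *)
Lemma near_enormP x (P : set 'rV[R]_m) :
  nbhs x P <-> exists2 e, 0 < e & forall y, enorm (y - x) < e -> P y.
Proof.
split=> [|[e e0 h]]; last by apply: filterS (near_enorm x e0).
rewrite -nbhs_ballE => -[e /= e0 h]; exists e => // y xy; apply: h.
by rewrite -ball_normE /= distrC (le_lt_trans (norm_le_enorm _)).
Qed.

End EuclideanSpace.

(** * Frechet differentials *)

Section Increments.
Context {R : realType} {m : nat}.
Implicit Types (x y z v g : 'rV[R]_m) (f : 'rV[R]_m -> R) (c e : R).

Lemma basis_vecE (i j : 'I_m) : (basis_vec i : 'rV[R]_m) 0 j = (j == i)%:R.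
Proof. by rewrite mxE. Qed.

Lemma is_derive_line f z v t : derivable f (z + t *: v) v ->
  is_derive t (1 : R) (fun s : R => f (z + s *: v)) ('D_v f (z + t *: v)).
Proof.
have E : (fun h : R => h^-1 *: (((fun s : R => f (z + s *: v)) \o shift t) (h *: 1) -
    f (z + t *: v))) =
  (fun h => h^-1 *: ((f \o shift (z + t *: v)) (h *: v) - f (z + t *: v))).
  apply/funext => h /=; congr (_ *: (f _ - _)).
  by rewrite [h *: 1]mulr1 scalerDl addrCA.
by move=> df; split; rewrite /derivable /derive E.
Qed.

Lemma coord_increment f z (i : 'I_m) c a e :
  (forall t, `|t| <= `|c| -> derivable f (z + t *: basis_vec i) (basis_vec i) /\
     `|'D_(basis_vec i) f (z + t *: basis_vec i) - a| <= e) ->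
  `|f (z + c *: basis_vec i) - f z - a * c| <= e * `|c|.
Proof.
move=> h; pose phi t := f (z + t *: basis_vec i).
pose dphi t := 'D_(basis_vec i) f (z + t *: basis_vec i).
have der t : `|t| <= `|c| -> is_derive t (1 : R) phi (dphi t).
  by move=> tc; apply: is_derive_line; have [] := h t tc.
have cts l r : (forall t, l <= t <= r -> `|t| <= `|c|) ->
    {within `[l, r], continuous phi}.
  move=> lr; apply: derivable_within_continuous => t; rewrite in_itv/= => /lr tc.
  by have [] := der t tc.
suff [t tc E] : exists2 t, `|t| <= `|c| & phi c - phi 0 = dphi t * c.
  move: E; rewrite /phi scale0r addr0 => ->.
  by rewrite -mulrBl normrM ler_wpM2r//; have [] := h t tc.
case: (leP 0 c) => c0.
- have ab t : 0 <= t <= c -> `|t| <= `|c| by case/andP => ? ?; rewrite !ger0_norm.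
  have [|t + E] := @MVT_segment R phi dphi 0 c c0 _ (cts _ _ ab).
    by move=> t; rewrite in_itv/= => /andP[? ?]; apply: der; rewrite ab// !ltW.
  by rewrite in_itv/= => /ab tc; exists t => //; rewrite E subr0.
- have ab t : c <= t <= 0 -> `|t| <= `|c|.
    by case/andP => ? ?; rewrite !ler0_norm ?lerN2// ltW.
  have [|t + E] := @MVT_segment R phi dphi c 0 (ltW c0) _ (cts _ _ ab).
    by move=> t; rewrite in_itv/= => /andP[? ?]; apply: der; rewrite ab// !ltW.
  rewrite in_itv/= => /ab tc; exists t => //.
  by rewrite -opprB E sub0r mulrN opprK.
Qed.

(** The path from x to y changes one coordinate at a time, so only partial derivatives enter. It
    stays in the box centred at x with half-widths |y_j - x_j|, where the bound is assumed. *)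
Lemma partial_increment f x y g e :
  (forall z, (forall j, `|z 0 j - x 0 j| <= `|y 0 j - x 0 j|) ->
     forall i, derivable f z (basis_vec i) /\
       `|'D_(basis_vec i) f z - g 0 i| <= e) ->
  `|f y - f x - dot g (y - x)| <= e * \sum_i `|(y - x) 0 i|.
Proof.
move=> h.
pose pt (k : nat) : 'rV[R]_m := \row_j (if (j < k)%N then y 0 j else x 0 j).
have ptm : pt m = y by apply/rowP => j; rewrite mxE ltn_ord.
have pt0 : pt 0%N = x by apply/rowP => j; rewrite mxE.
suff H (k : nat) : (k <= m)%N ->
    `|f (pt k) - f x - \sum_(i < m | (i < k)%N) g 0 i * (y - x) 0 i| <=
    e * \sum_(i < m | (i < k)%N) `|(y - x) 0 i|.
  have := H m (leqnn m); rewrite ptm /dot.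
  by under eq_bigl do rewrite ltn_ord; under [in leRHS]eq_bigl do rewrite ltn_ord.
elim: k => [_|k IH km].
  by rewrite pt0 subrr sub0r !big_pred0// ?normrN ?normr0 ?mulr0.
pose i := Ordinal km.
have iltk (G : 'I_m -> R) : \sum_(j < m | (j < k.+1)%N) G j =
    G i + \sum_(j < m | (j < k)%N) G j.
  rewrite (bigD1 i)//=; congr (_ + _); apply: eq_bigl => j.
  by rewrite ltnS ltn_neqAle andbC -(inj_eq val_inj).
rewrite !iltk mulrDr.
have ptS : pt k.+1 = pt k + (y - x) 0 i *: basis_vec i.
  apply/rowP => j; rewrite [in RHS]mxE [X in _ + X]mxE basis_vecE !mxE.
  have [->|ji] := eqVneq j i.
    by rewrite ltnSn ltnn mulr1 addrC subrK.
  have jk : (j : nat) != k by apply: contra_neq ji => jk; apply: val_inj.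
  by rewrite mulr0 addr0 ltnS leq_eqVlt (negPf jk).
have step : `|f (pt k.+1) - f (pt k) - g 0 i * (y - x) 0 i| <=
    e * `|(y - x) 0 i|.
  rewrite ptS; apply: coord_increment => t tc; apply: h => j.
  rewrite [X in X - _]mxE [X in _ + X - _]mxE basis_vecE mxE.
  have [->|ji] := eqVneq j i; last first.
    by rewrite mulr0 addr0; case: ifP => // _; rewrite subrr normr0.
  by rewrite ltnn mulr1 addrC addKr (le_trans tc)// !mxE.
rewrite (_ : _ - _ = (f (pt k.+1) - f (pt k) - g 0 i * (y - x) 0 i) +
  (f (pt k) - f x - \sum_(j < m | (j < k)%N) g 0 j * (y - x) 0 j)); last ring.
by rewrite (le_trans (ler_normD _ _))// lerD// IH// ltnW.
Qed.

End Increments.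

(* Frechet differentiability at x with gradient g; the directional derivatives
   of the library do not control f off the line they follow. *)
Definition dapprox {R : realType} {m : nat} (f : 'rV[R]_m -> R) (x g : 'rV[R]_m) :=
  forall e : R, 0 < e -> \forall y \near x,
    `|f y - f x - dot g (y - x)| <= e * enorm (y - x).

(** Vectors are rows, so the differential acts as [v *m M] and column i of M is the gradient of the
    i-th component. *)
Definition vapprox {R : realType} {m k : nat} (F : 'rV[R]_m -> 'rV[R]_k)
    (x : 'rV[R]_m) (M : 'M[R]_(m, k)) :=
  forall i, dapprox (fun y => F y 0 i) x (col i M)^T.

Section Differentials.
Context {R : realType} {m : nat}.
Implicit Types (x y z v g : 'rV[R]_m) (f : 'rV[R]_m -> R) (c e : R).

Lemma dapprox_near_eq f1 f2 x g :
  (\near x, f1 x = f2 x) -> dapprox f1 x g -> dapprox f2 x g.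
Proof.
move=> ef df e e0; have ex := nbhs_singleton ef.
by apply: filterS2 ef (df e e0) => y <-; rewrite -ex.
Qed.

Lemma dapprox_lip f x g : dapprox f x g ->
  \forall y \near x, `|f y - f x| <= (enorm g + 1) * enorm (y - x).
Proof.
move=> /(_ 1 ltr01); apply: filterS => y h.
rewrite -(subrK (dot g (y - x)) (f y - f x)) addrC mulrDl.
by rewrite (le_trans (ler_normD _ _))// lerD// dot_le.
Qed.

Lemma dapprox_continuous f x g : dapprox f x g -> {for x, continuous f}.
Proof.
move=> /dapprox_lip df; apply/(@cvgrPdist_lt _ _ _ _ (nbhs_filter x)) => e e0.
have K0 : 0 < enorm g + 1 by rewrite ltr_wpDl// enorm_ge0.
near=> y; rewrite distrC (@le_lt_trans _ _ ((enorm g + 1) * enorm (y - x)))//.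
  by near: y.
by rewrite mulrC -ltr_pdivlMr//; near: y; apply: near_enorm; rewrite divr_gt0.
Unshelve. all: by end_near. Qed.

Lemma dapprox_is_derive f x g v : dapprox f x g -> is_derive x v f (dot g v).
Proof.
move=> df.
suff H : h^-1 *: ((f \o shift x) (h *: v) - f x) @[h --> 0^'] --> dot g v.
  by split; [apply/cvg_ex; exists (dot g v) | exact/cvg_lim].
apply/cvgrPdist_le => e e0.
have K0 : 0 < enorm v + 1 by rewrite ltr_wpDl// enorm_ge0.
have /df/near_enormP[d d0 hd] : 0 < e / (enorm v + 1) by rewrite divr_gt0.
near=> h.
have h0 : h != 0 by near: h; exact: nbhs_dnbhs_neq.
have hn : 0 < `|h| by rewrite normr_gt0.
have hvd : enorm (h *: v + x - x) < d.
  have : `|h| < d / (enorm v + 1).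
    by near: h; apply: dnbhs0_lt; rewrite divr_gt0.
  rewrite addrK enormZ ltr_pdivlMr// => /le_lt_trans; apply.
  by rewrite ler_wpM2l// lerDl.
have := hd _ hvd; rewrite /= addrK dotZr enormZ => H.
rewrite distrC -[X in X - dot g v]/(h^-1 * _).
rewrite -(ler_pM2l hn) -normrM mulrBr mulrA mulfV// mul1r (le_trans H)//.
rewrite mulrCA ler_pM2l// -mulrA ger_pMr// mulrC ler_pdivrMr// mul1r.
by rewrite lerDl.
Unshelve. all: by end_near. Qed.

Lemma dapprox_mul f1 f2 x g1 g2 : dapprox f1 x g1 -> dapprox f2 x g2 ->
  dapprox (fun y => f1 y * f2 y) x (f1 x *: g2 + f2 x *: g1).
Proof.
move=> d1 d2 e e0; have l1' := dapprox_lip d1; have l2' := dapprox_lip d2.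
have [K1 K2] : 0 < enorm g1 + 1 /\ 0 < enorm g2 + 1.
  by split; rewrite ltr_wpDl// enorm_ge0.
have H1' := d1 (e / 3 / (`|f2 x| + 1)).
have H2' := d2 (e / 3 / (`|f1 x| + 1)).
near=> y.
have l1 : `|f1 y - f1 x| <= (enorm g1 + 1) * enorm (y - x) by near: y.
have l2 : `|f2 y - f2 x| <= (enorm g2 + 1) * enorm (y - x) by near: y.
have E3 : enorm (y - x) <= e / 3 / ((enorm g1 + 1) * (enorm g2 + 1)).
  by apply/ltW; near: y; apply: near_enorm; rewrite !divr_gt0 ?mulr_gt0.
have H1 : `|f1 y - f1 x - dot g1 (y - x)| <=
    e / 3 / (`|f2 x| + 1) * enorm (y - x).
  by near: y; apply: H1'; rewrite !divr_gt0// ltr_wpDl.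
have H2 : `|f2 y - f2 x - dot g2 (y - x)| <=
    e / 3 / (`|f1 x| + 1) * enorm (y - x).
  by near: y; apply: H2'; rewrite !divr_gt0// ltr_wpDl.
rewrite dotDl !dotZl (_ : _ - _ = f1 x * (f2 y - f2 x - dot g2 (y - x)) +
  f2 x * (f1 y - f1 x - dot g1 (y - x)) + (f1 y - f1 x) * (f2 y - f2 x));
  last ring.
have n0 := enorm_ge0 (y - x).
have bnd (a b : R) : 0 <= b -> `|a| * (e / 3 / (`|a| + 1) * b) <= e / 3 * b.
  move=> b0; rewrite mulrA ler_wpM2r// mulrCA ger_pMr ?divr_gt0//.
  by rewrite ler_pdivrMr ?mul1r ?lerDl// ltr_wpDl.
rewrite (_ : e = e / 3 + e / 3 + e / 3); last by field.
rewrite [leRHS]mulrDl [X in _ <= X + _]mulrDl (le_trans (ler_normD _ _))// lerD//.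
  rewrite (le_trans (ler_normD _ _))// lerD// normrM.
    by rewrite (le_trans (ler_wpM2l _ H2))// bnd.
  by rewrite (le_trans (ler_wpM2l _ H1))// bnd.
rewrite normrM (le_trans (ler_pM _ _ l1 l2))// mulrACA mulrA ler_wpM2r//.
by move: E3; rewrite ler_pdivlMr ?mulr_gt0// mulrC.
Unshelve. all: by end_near. Qed.

Lemma dapprox_sum (I : Type) (r : seq I) (f : I -> 'rV[R]_m -> R) x
    (g : I -> 'rV[R]_m) : (forall i, dapprox (f i) x (g i)) ->
  dapprox (fun y => \sum_(i <- r) f i y) x (\sum_(i <- r) g i).
Proof.
move=> h; elim: r => [|i r IH] e e0.
  by near=> y; rewrite !big_nil dot0l !subr0 normr0 mulr_ge0 ?enorm_ge0// ltW.
have e2 : 0 < e / 2 by rewrite divr_gt0.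
near=> y.
have H1 : `|f i y - f i x - dot (g i) (y - x)| <= e / 2 * enorm (y - x).
  by near: y; exact: h.
have H2 : `|\sum_(j <- r) f j y - \sum_(j <- r) f j x -
    dot (\sum_(j <- r) g j) (y - x)| <= e / 2 * enorm (y - x).
  by near: y; exact: IH.
rewrite !big_cons dotDl (_ : _ - _ = f i y - f i x - dot (g i) (y - x) +
  (\sum_(j <- r) f j y - \sum_(j <- r) f j x - dot (\sum_(j <- r) g j) (y - x)));
  last ring.
by rewrite (splitr e) mulrDl (le_trans (ler_normD _ _))// lerD.
Unshelve. all: by end_near. Qed.

Lemma dapprox_invsqrt f x g : dapprox f x g -> 0 < f x ->
  dapprox (fun y => (Num.sqrt (f y))^-1) x (- (2 * Num.sqrt (f x) ^+ 3)^-1 *: g).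
Proof.
move=> df fx0 e e0; set a := Num.sqrt (f x).
have a0 : 0 < a by rewrite sqrtr_gt0.
have aE : f x = a ^+ 2 by rewrite sqr_sqrtr// ltW.
have a3 : 0 < 2 * a ^+ 3 by rewrite mulr_gt0// exprn_gt0.
have H1' := df (e / 2 * (2 * a ^+ 3)).
have K0 : 0 < enorm g + 1 by rewrite ltr_wpDl// enorm_ge0.
pose K := 10 * (enorm g + 1) ^+ 2.
have K1 : 0 < K by rewrite mulr_gt0// exprn_gt0.
near=> y; set b := Num.sqrt (f y).
have fy : a ^+ 2 / 4 < f y.
  near: y; apply: (cvgr_gt _ (dapprox_continuous df)).
  by rewrite aE ltr_pdivrMr// ltr_pMr ?exprn_gt0// ltrDl.
have bE : f y = b ^+ 2 by rewrite sqr_sqrtr// ltW// (lt_trans _ fy)// divr_gt0 ?exprn_gt0.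
have b0 : a / 2 < b.
  rewrite -ltr_sqr ?nnegrE ?sqrtr_ge0 ?divr_ge0 ?(ltW a0)// -bE.
  by rewrite exprMn exprVn -natrX.
have b00 : 0 < b by rewrite (lt_trans _ b0)// divr_gt0.
have H1 : `|f y - f x - dot g (y - x)| <= e / 2 * (2 * a ^+ 3) * enorm (y - x).
  by near: y; apply: H1'; rewrite mulr_gt0// divr_gt0.
have L : `|f y - f x| <= (enorm g + 1) * enorm (y - x).
  by near: y; exact: dapprox_lip df.
have n0 := enorm_ge0 (y - x).
have nK : enorm (y - x) * K <= e / 2 * (2 * a ^+ 3) * (a ^+ 2).
  rewrite -ler_pdivlMr//; apply/ltW; near: y; apply: near_enorm.
  by rewrite divr_gt0// mulr_gt0 ?exprn_gt0// mulr_gt0// divr_gt0.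
(* The error is the linearization error of f plus a term quadratic in b - a, with no further
   remainder. *)
have E : b^-1 - a^-1 - dot (- (2 * a ^+ 3)^-1 *: g) (y - x) =
    (2 * a ^+ 3)^-1 * (- (f y - f x - dot g (y - x)) +
      (b - a) ^+ 2 * (b + 2 * a) / b).
  rewrite dotZl bE aE; field.
  by rewrite !gt_eqF.
have ab : `|b - a| * a <= (enorm g + 1) * enorm (y - x).
  apply: le_trans L; rewrite bE aE subr_sqr normrM ler_wpM2l//.
  by rewrite gtr0_norm ?addr_gt0// lerDr ltW.
rewrite E normrM gtr0_norm ?invr_gt0// mulrC ler_pdivrMr//.
rewrite (_ : e * _ * _ = e / 2 * (2 * a ^+ 3) * enorm (y - x) +
  e / 2 * (2 * a ^+ 3) * enorm (y - x)); last by field.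
rewrite (le_trans (ler_normD _ _))// normrN lerD//.
(* Since a <= 2 b, the quotient (b + 2 a) / b is at most 5; the constant in [K] was taken large
   enough to absorb it. *)
have Q : `|(b - a) ^+ 2 * (b + 2 * a) / b| <= 5 * (b - a) ^+ 2.
  rewrite ger0_norm; last first.
    by rewrite divr_ge0 ?(ltW b00)// mulr_ge0 ?sqr_ge0// addr_ge0 ?mulr_ge0 ?ltW.
  have a2b : a <= 2 * b by rewrite mulrC -ler_pdivrMr// ltW.
  rewrite ler_pdivrMr// [leRHS]mulrAC [leRHS]mulrC ler_wpM2l ?sqr_ge0//.
  by clear - a2b; lra.
rewrite (le_trans Q)// -(ler_pM2r (exprn_gt0 2 a0)).
have : (`|b - a| * a) ^+ 2 <= ((enorm g + 1) * enorm (y - x)) ^+ 2.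
  by rewrite ler_sqr ?nnegrE ?mulr_ge0// ltW.
rewrite !exprMn real_normK ?num_real// => /(ler_wpM2l (ler0n R 5)) h.
rewrite -[leLHS]mulrA (le_trans h)// [leRHS]mulrAC.
apply: le_trans (ler_wpM2r n0 nK); rewrite /K.
have : 0 <= (enorm g + 1) ^+ 2 * enorm (y - x) ^+ 2 by rewrite mulr_ge0 ?sqr_ge0.
by clear; lra.
Unshelve. all: by end_near. Qed.

End Differentials.

Section VectorDifferentials.
Context {R : realType}.

Lemma near_all m k (x : 'rV[R]_m) (P : 'I_k -> 'rV[R]_m -> Prop) :
  (forall i, \forall y \near x, P i y) -> \forall y \near x, forall i, P i y.
Proof. exact: (@filter_forall _ _ P (nbhs x) (nbhs_filter x)). Qed.

Lemma mulmx_coord m k (M : 'M[R]_(m, k)) (h : 'rV[R]_m) i :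
  dot (col i M)^T h = (h *m M) 0 i.
Proof. by rewrite mxE; apply: eq_bigr => j _; rewrite !mxE mulrC. Qed.

Lemma mulmx_bound m k (M : 'M[R]_(m, k)) :
  exists2 C : R, 0 < C & forall v, enorm (v *m M) <= C * enorm v.
Proof.
exists (\sum_j enorm (row j M) + 1) => [|v].
  by rewrite ltr_wpDl// sumr_ge0// => j _; exact: enorm_ge0.
rewrite mulmx_sum_row (le_trans (enorm_sum _ _))//.
apply: (@le_trans _ _ ((\sum_j enorm (row j M)) * enorm v)).
  rewrite mulr_suml; apply: ler_sum => j _.
  by rewrite enormZ mulrC ler_wpM2l ?enorm_ge0// coord_le.
by rewrite ler_wpM2r ?enorm_ge0// lerDl.
Qed.

Lemma vapproxP m k (F : 'rV[R]_m -> 'rV[R]_k) x (M : 'M[R]_(m, k)) :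
  vapprox F x M <-> forall e : R, 0 < e -> \forall y \near x,
    enorm (F y - F x - (y - x) *m M) <= e * enorm (y - x).
Proof.
split=> [dF e e0|dF i e e0]; last first.
  apply: filterS (dF e e0) => y; apply: le_trans.
  by apply: le_trans (coord_le _ i); rewrite mulmx_coord !mxE.
have e1 : 0 < e / k.+1%:R by rewrite divr_gt0.
have := near_all (fun i => dF i _ e1).
apply: filterS => y h; rewrite (le_trans (enorm_le_sum _))//.
have n0 := enorm_ge0 (y - x).
apply: (@le_trans _ _ (\sum_(i < k) e / k.+1%:R * enorm (y - x))).
  by apply: ler_sum => i _; apply: le_trans (h i); rewrite mulmx_coord !mxE.
rewrite sumr_const card_ord -mulrnAl ler_wpM2r//.
by rewrite -mulr_natr mulrAC ler_pdivrMr// ler_pM2l// ler_nat.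
Qed.

Lemma vapprox_lip m k (F : 'rV[R]_m -> 'rV[R]_k) x (M : 'M[R]_(m, k)) :
  vapprox F x M -> exists2 K : R, 0 < K &
    \forall y \near x, enorm (F y - F x) <= K * enorm (y - x).
Proof.
move=> /vapproxP/(_ 1 ltr01) dF; have [C C0 hC] := mulmx_bound M.
exists (1 + C); first by rewrite addr_gt0.
apply: filterS dF => y h.
rewrite -(subrK ((y - x) *m M) (F y - F x)) (le_trans (enormD _ _))//.
by rewrite mulrDl lerD.
Qed.

Lemma near_lip m k (F : 'rV[R]_m -> 'rV[R]_k) x (K : R) (P : set 'rV[R]_k) :
  0 < K -> (\forall y \near x, enorm (F y - F x) <= K * enorm (y - x)) ->
  nbhs (F x) P -> \forall y \near x, P (F y).
Proof.
move=> K0 FK /near_enormP[e e0 h].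
have := near_enorm x (divr_gt0 e0 K0).
apply: filterS2 FK => y h1 h2; apply: h; rewrite (le_lt_trans h1)//.
by rewrite mulrC -ltr_pdivlMr.
Qed.

Lemma vapprox_near m k (F : 'rV[R]_m -> 'rV[R]_k) x (M : 'M[R]_(m, k)) P :
  vapprox F x M -> nbhs (F x) P -> \forall y \near x, P (F y).
Proof. by move=> /vapprox_lip[K K0 h]; exact: near_lip h. Qed.

Lemma vapprox_near_eq m k (F G : 'rV[R]_m -> 'rV[R]_k) x (M : 'M[R]_(m, k)) :
  (\near x, F x = G x) -> vapprox F x M -> vapprox G x M.
Proof.
move=> FG dF i; apply: dapprox_near_eq (dF i).
by apply: filterS FG => y ->.
Qed.

Lemma vapprox_comp m k l (F : 'rV[R]_m -> 'rV[R]_k) (G : 'rV[R]_k -> 'rV[R]_l)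
    x (M : 'M[R]_(m, k)) (N : 'M[R]_(k, l)) :
  vapprox F x M -> vapprox G (F x) N -> vapprox (G \o F) x (M *m N).
Proof.
move=> dF dG; apply/vapproxP => e e0.
have [K K0 hK] := vapprox_lip dF; have [C C0 hC] := mulmx_bound N.
have e1 : 0 < e / 2 / K by rewrite !divr_gt0.
have e2 : 0 < e / 2 / C by rewrite !divr_gt0.
have H1 := near_lip K0 hK ((vapproxP _ _ _).1 dG _ e1).
have H2 := (vapproxP _ _ _).1 dF _ e2.
near=> y.
have hKy : enorm (F y - F x) <= K * enorm (y - x) by near: y.
have h1 : enorm (G (F y) - G (F x) - (F y - F x) *m N) <=
  e / 2 / K * enorm (F y - F x) by near: y.
have h2 : enorm (F y - F x - (y - x) *m M) <= e / 2 / C * enorm (y - x).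
  by near: y.
rewrite /= (_ : _ - _ = (G (F y) - G (F x) - (F y - F x) *m N) +
  (F y - F x - (y - x) *m M) *m N); last first.
  by rewrite [X in _ = _ + X]mulmxBl mulmxA [RHS]addrA subrK.
rewrite (le_trans (enormD _ _))// [in leRHS](splitr e) mulrDl lerD//.
  rewrite (le_trans h1)// -mulrA ler_pM2l ?divr_gt0// mulrC.
  by rewrite ler_pdivrMr// mulrC.
rewrite (le_trans (hC _))// (le_trans (ler_wpM2l (ltW C0) h2))//.
by rewrite mulrA mulrCA mulfV ?mulr1// gt_eqF.
Unshelve. all: by end_near. Qed.

Lemma vapprox_is_derive m k (F : 'rV[R]_m -> 'rV[R]_k) x v (M : 'M[R]_(m, k)) :
  vapprox F x M -> is_derive x v F (v *m M).
Proof.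
move=> dF.
have H i : is_derive x v (fun y => F y 0 i) ((v *m M) 0 i).
  by rewrite -mulmx_coord; exact: dapprox_is_derive.
have dr : derivable F x v.
  by apply/derivable_mxP => i j; rewrite ord1; have [] := H j.
split=> //; rewrite (derive_mx dr); apply/rowP => j; rewrite [LHS]mxE.
by have [] := H j.
Qed.

End VectorDifferentials.

(** * Functions of class C^1 and C^2: mean value estimates, symmetry of the Hessian, Taylor
    remainder *)

Section C1.
Context {R : realType} {m : nat}.
Implicit Types (x y z v g : 'rV[R]_m) (f : 'rV[R]_m -> R) (c e : R).

Lemma enorm_le_coord x y : (forall j, `|x 0 j| <= `|y 0 j|) -> enorm x <= enorm y.
Proof.
move=> h; apply: ler_wsqrtr; apply: ler_sum => j _.
by rewrite -!expr2 -(real_normK (num_real (x 0 j))) -(real_normK (num_real (y 0 j)))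
  ler_sqr ?nnegrE.
Qed.

Lemma near_continuous f x e : {for x, continuous f} -> 0 < e ->
  \forall y \near x, `|f y - f x| <= e.
Proof.
move=> /(@cvgrPdist_lt _ _ _ _ (nbhs_filter x)) cf e0.
by apply: filterS (cf e e0) => y; rewrite distrC => /ltW.
Qed.

(** A pointwise notion: the partial derivatives exist near x but are continuous only at x, which is
    enough for mean value estimates on a small ball. *)
Definition C1_at f x :=
  (\forall y \near x, forall i, derivable f y (basis_vec i)) /\
  forall i, {for x, continuous ('D_(basis_vec i) f)}.

Lemma C1_dapprox f x : C1_at f x -> dapprox f x (grad f x).
Proof.
move=> [dr ct] e e0.
have e1 : 0 < e / m.+1%:R by rewrite divr_gt0.
have := near_all (fun i => near_continuous (ct i) e1).
move=> /(filterI dr)/near_enormP[d d0 H].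
apply/near_enormP; exists d => // y yx.
apply: (@le_trans _ _ (e / m.+1%:R * \sum_i `|(y - x) 0 i|)).
  apply: partial_increment => z zx i; rewrite mxE.
  have zd : enorm (z - x) < d.
    by rewrite (le_lt_trans _ yx)//; apply: enorm_le_coord => j; rewrite !mxE.
  by have [h1 h2] := H z zd; split.
have n0 := enorm_ge0 (y - x).
rewrite (le_trans (ler_wpM2l (ltW e1) (sum_coord_le _)))// mulrA ler_wpM2r//.
by rewrite mulrAC ler_pdivrMr// ler_pM2l// ler_nat.
Qed.

Lemma C1_lip f x0 : C1_at f x0 ->
  exists K e : R, [/\ 0 < K, 0 < e & forall x y, enorm (x - x0) < e ->
    enorm (y - x0) < e -> `|f y - f x| <= K * enorm (y - x)].
Proof.
move=> [dr ct].
have := near_all (fun i => near_continuous (ct i) ltr01).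
move=> /(filterI dr)/near_enormP[d d0 H].
pose B := \sum_i (`|'D_(basis_vec i) f x0| + 1).
have B0 : 0 <= B by apply: sumr_ge0 => i _; rewrite addr_ge0.
(* With x and y within d / 3 of x0, every point as close to x as y is stays within d of x0. *)
exists (B * m%:R + 1), (d / 3); split; rewrite ?divr_gt0 ?ltr_wpDl ?mulr_ge0//.
move=> x y xd yd.
apply: (@le_trans _ _ (B * \sum_i `|(y - x) 0 i|)).
  rewrite -[X in `|X|]subr0 -[X in _ - X](dot0l (y - x)).
  apply: partial_increment => z zx i; rewrite mxE subr0.
  have zd : enorm (z - x0) < d.
    have : enorm (z - x) <= enorm (y - x).
      by apply: enorm_le_coord => j; rewrite !mxE.
    have := enorm_dist z x x0; have := enorm_dist y x0 x.
    rewrite (enormB x0 x); move: xd yd; lra.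
  have [h1 h2] := H z zd; split => //.
  rewrite /B (bigD1 i)//= -[leLHS]addr0 lerD//; last first.
    by apply: sumr_ge0 => j _; rewrite addr_ge0.
  rewrite -(subrK ('D_(basis_vec i) f x0) ('D_(basis_vec i) f z)) addrC.
  by rewrite (le_trans (ler_normD _ _))// lerD2l.
have n0 := enorm_ge0 (y - x).
rewrite (le_trans (ler_wpM2l B0 (sum_coord_le _)))// mulrA ler_wpM2r//.
by rewrite lerDl.
Qed.

Lemma is_derive_shift f x w v : derivable f (x + w) v ->
  is_derive x v (fun y => f (y + w)) ('D_v f (x + w)).
Proof.
have E : (fun h : R => h^-1 *: (((fun y => f (y + w)) \o shift x) (h *: v) -
    f (x + w))) = (fun h => h^-1 *: ((f \o shift (x + w)) (h *: v) - f (x + w))).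
  by apply/funext => h /=; rewrite addrA.
by move=> df; split; rewrite /derivable /derive E.
Qed.

Lemma is_derive_increment f x w v : derivable f (x + w) v -> derivable f x v ->
  is_derive x v (fun y => f (y + w) - f y) ('D_v f (x + w) - 'D_v f x).
Proof.
move=> d1 d2; exact: (is_deriveB (is_derive_shift d1) (derivableP d2)).
Qed.

Lemma Ck_on2P (U : set 'rV[R]_m) f x : open U -> Ck_on 2 U f -> U x ->
  [/\ {for x, continuous f}, C1_at f x & forall i, C1_at ('D_(basis_vec i) f) x].
Proof.
move=> oU ck Ux; split.
- by have [] := ck [::] isT x Ux.
- split=> [|i]; last by have [] := ck [:: i] isT x Ux.
  apply: filterS (open_nbhs_nbhs (conj oU Ux)) => y Uy i.
  by have [_ /(_ isT)] := ck [::] isT y Uy.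
- move=> i; split=> [|j]; last by have [] := ck [:: j; i] isT x Ux.
  apply: filterS (open_nbhs_nbhs (conj oU Ux)) => y Uy j.
  by have [_ /(_ isT)] := ck [:: i] isT y Uy.
Qed.

Definition hess f x : 'M[R]_m :=
  \matrix_(i, j) 'D_(basis_vec i) ('D_(basis_vec j) f) x.

Lemma grad_vapprox f x : (forall i, C1_at ('D_(basis_vec i) f) x) ->
  vapprox (grad f) x (hess f x).
Proof.
move=> c1 j e e0; have := C1_dapprox (c1 j) e0; apply: filterS => y.
rewrite !mxE; congr (`|_ - _ - dot _ _| <= _).
by apply/rowP => i; rewrite !mxE.
Qed.

(** The mean value theorem in direction i is applied to y -> f(y + h e_j) - f(y), whose i-th partial
    is an increment of the i-th partial of f in direction j. *)
Lemma second_difference f x i j e : C1_at f x -> C1_at ('D_(basis_vec i) f) x ->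
  0 < e -> exists2 d : R, 0 < d & forall h, 0 < h -> h < d ->
  `|f (x + h *: basis_vec i + h *: basis_vec j) - f (x + h *: basis_vec i) -
    (f (x + h *: basis_vec j) - f x) -
    h * ('D_(basis_vec j) ('D_(basis_vec i) f) x) * h| <= e * h * h.
Proof.
move=> [dr _] /C1_dapprox c2 e0.
(* The differential of the i-th partial is used at two points within h and 2 h of x, so the errors
   total 3 h times e / 3. *)
have e3 : 0 < e / 3 by rewrite divr_gt0.
have [d d0 H] := (near_enormP _ _).1 (filterI dr (c2 _ e3)).
exists (d / 2) => [|h h0 hd]; first by rewrite divr_gt0.
have := @coord_increment _ _ (fun y => f (y + h *: basis_vec j) - f y) x i h
  (h * ('D_(basis_vec j) ('D_(basis_vec i) f) x)) (e * h).
rewrite (gtr0_norm h0); apply => t th.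
pose p1 := x + t *: basis_vec i.
have n1 : enorm (p1 - x) <= h by rewrite addrC addKr enormZ enorm_basis mulr1.
have n2 : enorm (p1 + h *: basis_vec j - x) <= 2 * h.
  rewrite addrAC (le_trans (enormD _ _))// mulr2n mulrDl !mul1r lerD//.
  by rewrite enormZ enorm_basis mulr1 gtr0_norm.
have [D1 A1] : _ /\ _ := H p1 ltac:(lra).
have [D2 A2] : _ /\ _ := H (p1 + h *: basis_vec j) ltac:(lra).
have [S1 S2] := is_derive_increment (D2 i) (D1 i).
rewrite -/p1; split; first exact: S1.
rewrite S2.
have E : p1 + h *: basis_vec j - x = (p1 - x) + h *: basis_vec j.
  by rewrite addrAC.
rewrite E dotDr dotZr dot_basis mxE in A2; rewrite E in n2.
set a2 := 'D_(basis_vec i) f (p1 + _) in A2 *.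
set a1 := 'D_(basis_vec i) f p1 in A1 *.
set b := 'D_(basis_vec j) _ x in A2 *.
rewrite (_ : _ - _ = (a2 - 'D_(basis_vec i) f x -
   (dot (grad ('D_(basis_vec i) f) x) (p1 - x) + h * b)) -
   (a1 - 'D_(basis_vec i) f x - dot (grad ('D_(basis_vec i) f) x) (p1 - x)));
   last ring.
rewrite (le_trans (ler_normB _ _))// (_ : e * h = e / 3 * (2 * h) + e / 3 * h);
  last by field.
rewrite lerD//.
  by apply: le_trans A2 _; rewrite ler_pM2l.
by apply: le_trans A1 _; rewrite ler_pM2l.
Qed.

(** Schwarz: the mixed second difference is symmetric in i and j, and divided by h^2 it approximates
    both mixed partials. *)
Lemma hess_sym f x : C1_at f x -> (forall i, C1_at ('D_(basis_vec i) f) x) ->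
  (hess f x)^T = hess f x.
Proof.
move=> c1 c2; apply/matrixP => i j; rewrite !mxE; apply/eqP.
rewrite -subr_eq0 -normr_le0; apply/ler_addgt0Pl => e e0; rewrite addr0.
have e2 : 0 < e / 2 by rewrite divr_gt0.
have [d1 d10 A] := second_difference j c1 (c2 i) e2.
have [d2 d20 B] := second_difference i c1 (c2 j) e2.
pose h := Num.min d1 d2 / 2.
have h0 : 0 < h by rewrite divr_gt0// lt_min d10.
have : h < Num.min d1 d2 by rewrite ltr_pdivrMr// ltr_pMr ?ltr1n// lt_min d10.
rewrite lt_min => /andP[hd1 hd2].
have {}A := A h h0 hd1; have {B} := B h h0 hd2.
rewrite (addrAC x (h *: basis_vec j)).
set a := 'D_(basis_vec j) _ x; set b := 'D_(basis_vec i) _ x.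
set P := f (x + h *: basis_vec i + h *: basis_vec j).
set Q := f (x + h *: basis_vec i); set S := f (x + h *: basis_vec j) => B.
have E : `|a - b| * h * h = `|(P - S - (Q - f x) - h * b * h) -
    (P - Q - (S - f x) - h * a * h)|.
  by rewrite -{1 2}(gtr0_norm h0) -!normrM; congr (`|_|); ring.
rewrite -(ler_pM2r h0) -(ler_pM2r h0) E.
have -> : e * h * h = e / 2 * h * h + e / 2 * h * h by field.
apply: le_trans (ler_normB _ _) _; exact: lerD B A.
Qed.

(** The partials are Lipschitz near x0, so the mean value estimate has a quadratic error. Uniformity
    in the base point x is what makes the constant of the touching balls locally uniform. *)
Lemma taylor2 f x0 : (\forall y \near x0, forall i, derivable f y (basis_vec i)) ->
  (forall i, C1_at ('D_(basis_vec i) f) x0) ->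
  exists K e : R, [/\ 0 < K, 0 < e & forall x y, enorm (x - x0) < e ->
    enorm (y - x0) < e ->
    `|f y - f x - dot (grad f x) (y - x)| <= K * enorm (y - x) ^+ 2].
Proof.
move=> /near_enormP[d d0 dr] c2.
have /choice[K /choice[e lip]] := fun i => C1_lip (c2 i).
pose B := \sum_i K i; pose r := Num.min d (\big[Num.min/1]_i e i).
have KB i : K i <= B.
  rewrite /B (bigD1 i)//= lerDl sumr_ge0// => j _.
  by have [/ltW] := lip j.
have r0 : 0 < r.
  rewrite lt_min d0 /=; apply: lt_bigmin => // i _.
  by have [] := lip i.
have re i : r <= e i by rewrite ge_min bigmin_le orbT.
have B0 : 0 <= B by apply: sumr_ge0 => i _; have [/ltW] := lip i.
exists (B * m%:R + 1), (r / 3); split; rewrite ?divr_gt0 ?ltr_wpDl ?mulr_ge0//.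
move=> x y xd yd; have n0 := enorm_ge0 (y - x).
apply: (@le_trans _ _ (B * enorm (y - x) * \sum_i `|(y - x) 0 i|)).
  apply: partial_increment => z zx i.
  have zxy : enorm (z - x) <= enorm (y - x).
    by apply: enorm_le_coord => j; rewrite !mxE.
  have zr : enorm (z - x0) < r.
    have := enorm_dist z x x0; have := enorm_dist y x0 x.
    rewrite (enormB x0 x); move: xd yd; lra.
  split; first by apply: dr; rewrite (lt_le_trans zr)// ge_min lexx.
  have [_ _ L] := lip i; rewrite mxE.
  apply: (@le_trans _ _ (K i * enorm (z - x))).
    by apply: L; rewrite (lt_le_trans _ (re i))//; lra.
  by rewrite ler_pM// ?enorm_ge0//; have [/ltW] := lip i.
rewrite (le_trans (ler_wpM2l _ (sum_coord_le _)))// ?mulr_ge0//.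
rewrite mulrACA -expr2 ler_wpM2r ?sqr_ge0//.
by rewrite lerDl.
Qed.

End C1.

(** * Unit normals and shape operators *)

Lemma mulmx_tr_dot {R : realType} m (u v : 'rV[R]_m) : u *m v^T = (dot u v)%:M.
Proof.
apply/matrixP => i j; rewrite !ord1 !mxE; apply: eq_bigr => k _.
by rewrite mxE.
Qed.

Section MatrixContinuity.
Context {R : realType} {T : topologicalType}.
Implicit Types (t : T).

Lemma near_eq_continuous (f1 f2 : T -> R) t :
  (\forall s \near t, f1 s = f2 s) -> {for t, continuous f1} ->
  {for t, continuous f2}.
Proof.
move=> E c; rewrite /prop_for /continuous_at -(nbhs_singleton E).
by apply: cvg_trans c; apply: near_eq_cvg.
Qed.

Definition mx_continuous m k (M : T -> 'M[R]_(m, k)) t :=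
  forall i j, {for t, continuous (fun s => M s i j)}.

Lemma mx_continuous_mul m k l (M : T -> 'M[R]_(m, k)) (N : T -> 'M[R]_(k, l)) t :
  mx_continuous M t -> mx_continuous N t ->
  mx_continuous (fun s => M s *m N s) t.
Proof.
move=> cM cN i j; rewrite /prop_for /continuous_at.
under eq_fun do rewrite mxE; rewrite mxE.
apply: cvg_big => [|x _].
  exact: add_continuous.
by apply: cvgM; [exact: cM | exact: cN].
Qed.

Lemma mx_continuous_sub m k (M N : T -> 'M[R]_(m, k)) t :
  mx_continuous M t -> mx_continuous N t -> mx_continuous (fun s => M s - N s) t.
Proof.
move=> cM cN i j; rewrite /prop_for /continuous_at.
under eq_fun do rewrite 2!mxE; rewrite 2!mxE.
by apply: cvgB; [exact: cM | exact: cN].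
Qed.

Lemma mx_continuous_scale m k (c : T -> R) (M : T -> 'M[R]_(m, k)) t :
  {for t, continuous c} -> mx_continuous M t ->
  mx_continuous (fun s => c s *: M s) t.
Proof.
move=> cc cM i j; rewrite /prop_for /continuous_at.
under eq_fun do rewrite mxE; rewrite mxE.
by apply: cvgM; [exact: cc | exact: cM].
Qed.

Lemma mx_continuous_tr m k (M : T -> 'M[R]_(m, k)) t :
  mx_continuous M t -> mx_continuous (fun s => (M s)^T) t.
Proof.
move=> cM i j; rewrite /prop_for /continuous_at.
under eq_fun do rewrite mxE; rewrite mxE; exact: cM.
Qed.

Lemma mx_continuous_det m (M : T -> 'M[R]_m) t :
  mx_continuous M t -> {for t, continuous (fun s => \det (M s))}.
Proof.
move=> cM; rewrite /prop_for /continuous_at /determinant.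
apply: cvg_big => [|p _].
  exact: add_continuous.
apply: cvgM; first exact: cvg_cst.
apply: cvg_big => [|x _].
  exact: mul_continuous.
exact: cM.
Qed.

(** Cramer's rule: near t the inverse is the adjugate divided by the determinant, both polynomial in
    the entries. *)
Lemma mx_continuous_inv m (M : T -> 'M[R]_m) t :
  mx_continuous M t -> (\forall s \near t, M s \in unitmx) ->
  mx_continuous (fun s => invmx (M s)) t.
Proof.
move=> cM uM i j; have ut := nbhs_singleton uM.
rewrite /prop_for /continuous_at.
suff H : ((\det (M s))^-1 * (\adj (M s)) i j) @[s --> t] -->
    (\det (M t))^-1 * (\adj (M t)) i j.
  rewrite /invmx ut mxE; apply: cvg_trans H; apply: near_eq_cvg.
  by apply: filterS uM => s us /=; rewrite us [in RHS]mxE.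
apply: cvgM.
  apply: cvgV; last exact: mx_continuous_det.
  by move: ut; rewrite unitmxE unitfE.
under eq_fun do rewrite mxE; rewrite mxE.
apply: cvgM; first exact: cvg_cst.
apply: mx_continuous_det => k l; rewrite /prop_for /continuous_at.
under eq_fun do rewrite !mxE; rewrite !mxE; exact: cM.
Qed.

Lemma mx_continuous_normalize m (G : T -> 'rV[R]_m) (H : T -> 'M[R]_m) t :
  G t != 0 -> mx_continuous G t -> mx_continuous H t ->
  mx_continuous (fun s => (enorm (G s))^-1 *: H s -
    (enorm (G s))^-3 *: (H s *m (G s)^T *m G s)) t.
Proof.
move=> g0 cg ch.
have cgt : mx_continuous (fun y => (G y)^T) t.
  exact: mx_continuous_tr.
have cn : {for t, continuous (fun y => (enorm (G y))^-1)}.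
  have cd : {for t, continuous (fun y => dot (G y) (G y))}.
    have /(_ 0 0) := mx_continuous_mul cg cgt; rewrite /prop_for /continuous_at.
    under eq_fun do rewrite mulmx_tr_dot mxE eqxx mulr1n.
    by rewrite mulmx_tr_dot mxE eqxx mulr1n.
  have ce : {for t, continuous (fun y => enorm (G y))}.
    exact: (continuous_comp cd (@sqrt_continuous R _)).
  rewrite /prop_for /continuous_at; apply: cvgV; first by rewrite enorm_eq0.
  exact: ce.
move=> i j; rewrite /prop_for /continuous_at.
have E y : ((enorm (G y))^-1 *: H y -
    (enorm (G y))^-3 *: (H y *m (G y)^T *m G y)) i j =
    (enorm (G y))^-1 * H y i j -
   (enorm (G y))^-1 * (enorm (G y))^-1 * (enorm (G y))^-1 *
   (H y *m (G y)^T *m G y) i j.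
  have -> : (enorm (G y))^-3 = (enorm (G y))^-1 * (enorm (G y))^-1 * (enorm (G y))^-1.
    by rewrite -exprVn !exprS mulrA expr0 mulr1.
  by move: (_ *m G y) => M; rewrite !mxE.
under eq_fun do rewrite E; rewrite E.
apply: cvgB; first by apply: cvgM; [exact: cn | exact: ch].
apply: cvgM; first by apply: cvgM; first apply: cvgM; exact: cn.
by apply: mx_continuous_mul; first exact: mx_continuous_mul.
Qed.

End MatrixContinuity.

Lemma mx_continuous_comp (R : realType) (T S : topologicalType) m k (F : T -> S)
    (M : S -> 'M[R]_(m, k)) t :
  {for t, continuous F} -> mx_continuous M (F t) ->
  mx_continuous (fun s => M (F s)) t.
Proof.
move=> cF cM i j; have cMij : {for F t, continuous (fun s => M s i j)} := cM i j.
exact: (continuous_comp cF cMij).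
Qed.

Section Normals.
Context {R : realType} {m : nat}.
Implicit Types (x y p u v w g : 'rV[R]_m) (f : 'rV[R]_m -> R) (e : R).
Implicit Types (A U : set 'rV[R]_m).

Definition unit_normal f x : 'rV[R]_m := (enorm (grad f x))^-1 *: grad f x.

Lemma unit_normal_unit f x : grad f x != 0 ->
  dot (unit_normal f x) (unit_normal f x) = 1.
Proof.
move=> g0; rewrite dotZl dotZr -sqr_enorm mulrA -expr2 -exprMn mulVf ?expr1n//.
by rewrite enorm_eq0.
Qed.

(** The differential of [unit_normal]: the normalized Hessian with the normal part of its image
    removed. On tangent vectors it is the shape operator. *)
Definition shape f x : 'M[R]_m :=
  (enorm (grad f x))^-1 *: hess f x -
  (enorm (grad f x))^-3 *: (hess f x *m (grad f x)^T *m grad f x).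

Lemma mulmx_shape f x v : v *m shape f x =
  (enorm (grad f x))^-1 *: (v *m hess f x) -
  ((enorm (grad f x))^-3 * dot (v *m hess f x) (grad f x)) *: grad f x.
Proof.
rewrite mulmxBr -!scalemxAr !mulmxA mulmx_tr_dot mul_scalar_mx.
by rewrite scalerA.
Qed.

(** The left side is what the product rule yields for the i-th component of G / |G| when |G|^2 is
    expanded into squares. *)
Lemma gradient_normalize (G : 'rV[R]_m) (H : 'M[R]_m) i : enorm G != 0 ->
  (enorm G)^-1 *: (col i H)^T +
    G 0 i *: (- (2 * enorm G ^+ 3)^-1 *: \sum_j (2 * G 0 j) *: (col j H)^T) =
  (col i ((enorm G)^-1 *: H - (enorm G)^-3 *: (H *m G^T *m G)))^T.
Proof.
move=> a0; apply/rowP => k.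
have -> : \sum_j (2 * G 0 j) *: (col j H)^T = 2 *: (H *m G^T)^T.
  apply/rowP => l; rewrite summxE !mxE mulr_sumr; apply: eq_bigr => j _.
  by rewrite !mxE; ring.
have : (H *m G^T *m G) k i = (H *m G^T) k 0 * G 0 i by rewrite mxE big_ord1.
move: (H *m G^T) => C; move: (C *m G) => CG ECG.
by rewrite !mxE ECG; field.
Qed.

Lemma unit_normal_vapprox f x : grad f x != 0 ->
  (forall i, C1_at ('D_(basis_vec i) f) x) ->
  vapprox (unit_normal f) x (shape f x).
Proof.
move=> g0 c1 i.
have dg := grad_vapprox c1; set G := grad f x in g0 *.
have a0 : 0 < enorm G by rewrite enorm_gt0.
have dd := @dapprox_sum R m _ (index_enum 'I_m) _ x _
  (fun j => dapprox_mul (dg j) (dg j)).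
have G0 : 0 < dot G G by rewrite -sqr_enorm exprn_gt0.
have := dapprox_mul (dapprox_invsqrt dd G0) (dg i).
rewrite -/G -/(dot G G) -/(enorm G) => D.
rewrite (_ : (fun y => _) = (fun y => (enorm (grad f y))^-1 * grad f y 0 i));
  last by apply/funext => y; rewrite mxE.
congr (dapprox _ _ _): D.
rewrite -gradient_normalize ?enorm_eq0//; congr (_ + _ *: (_ *: _)).
by apply: eq_bigr => j _; rewrite -/G mulr2n mulrDl mul1r scalerDl.
Qed.

Lemma shape_tangent f x v : grad f x != 0 -> dot (v *m shape f x) (grad f x) = 0.
Proof.
move=> g0; rewrite mulmx_shape dotBl !dotZl -sqr_enorm.
by field; rewrite enorm_eq0.
Qed.

Lemma dot_mulmx_sym (H : 'M[R]_m) u v : H^T = H ->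
  dot (u *m H) v = dot (v *m H) u.
Proof.
move=> sH; have E a b : dot (a *m H) b = (a *m H *m b^T) 0 0.
  by rewrite mulmx_tr_dot mxE eqxx mulr1n.
rewrite !E -[in LHS](trmxK (u *m H *m v^T)) [LHS]mxE.
by rewrite !trmx_mul trmxK sH mulmxA.
Qed.

(** Against tangent vectors the correction term of [shape] disappears and the symmetric Hessian
    remains. *)
Lemma shape_sym f x u v : C1_at f x -> (forall i, C1_at ('D_(basis_vec i) f) x) ->
  dot (grad f x) u = 0 -> dot (grad f x) v = 0 ->
  dot (u *m shape f x) v = dot (v *m shape f x) u.
Proof.
move=> c1 c2 gu gv; rewrite !mulmx_shape !dotBl !dotZl gu gv !mulr0.
by rewrite (dot_mulmx_sym _ _ (hess_sym c1 c2)).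
Qed.

Lemma shape_continuous f x : grad f x != 0 ->
  (forall i, C1_at ('D_(basis_vec i) f) x) -> mx_continuous (shape f) x.
Proof.
move=> g0 c1.
have cg : mx_continuous (grad f) x.
  by move=> i j; rewrite ord1; exact: dapprox_continuous (grad_vapprox c1 j).
have ch : mx_continuous (hess f) x.
  move=> i j; rewrite /prop_for /continuous_at.
  under eq_fun do rewrite mxE; rewrite mxE.
  by have [_] := c1 j; apply.
exact: mx_continuous_normalize.
Qed.

(** If the part h of g orthogonal to w were nonzero, w + s h with s large would lie in the
    half-space of w and make <g, .> positive. So g is a multiple of w, and the sign follows from u =
    w. *)
Lemma halfspace_normal g w : g != 0 -> w != 0 ->
  (forall u, 0 < dot w u -> dot g u <= 0) ->
  (enorm g)^-1 *: g = - ((enorm w)^-1 *: w).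
Proof.
move=> g0 w0 H.
have ww : 0 < dot w w by rewrite lt_def dot_eq0 w0 dot_ge0.
pose c := - dot g w / dot w w; pose h := g + c *: w.
have hw : dot h w = 0 by rewrite dotDl dotZl; rewrite /c; field; rewrite gt_eqF.
have gh : dot g h = dot h h.
  by rewrite -[in LHS](addrK (c *: w) g) -/h dotBl dotZl (dotC w) hw mulr0 subr0.
have h0 : h = 0.
  apply/eqP; rewrite -dot_eq0; apply: contraT => hh0.
  have hh : 0 < dot h h by rewrite lt_def hh0 dot_ge0.
  (* Chosen so that <g, w + s h> = 1. *)
  pose s := (1 - dot g w) / dot h h.
  have := H (w + s *: h); rewrite !dotDr !dotZr (dotC w h) hw mulr0 addr0 => /(_ ww).
  by rewrite gh /s divfK// addrC subrK ler10.
have gE : g = - c *: w.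
  by apply/eqP; rewrite -subr_eq0 scaleNr opprK -/h h0.
have c0 : 0 < c.
  rewrite lt_def; apply/andP; split.
    by apply: contraNneq g0 => c0; rewrite gE c0 oppr0 scale0r.
  by rewrite divr_ge0 ?dot_ge0// oppr_ge0 H.
have wn : enorm w != 0 by rewrite enorm_eq0.
rewrite gE enormZ normrN gtr0_norm// scalerA invfM mulrN scaleNr.
by rewrite mulrAC mulVf ?mul1r ?gt_eqF.
Qed.

Lemma near_line p u (P : set 'rV[R]_m) : nbhs p P ->
  exists2 d : R, 0 < d & forall s : R, 0 < s -> s < d -> P (p + s *: u).
Proof.
move=> /near_enormP[e e0 H].
have u0 : 0 < enorm u + 1 by rewrite ltr_wpDl// enorm_ge0.
exists (e / (enorm u + 1)) => [|s s0 sd]; first by rewrite divr_gt0.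
apply: H; rewrite addrC addKr enormZ gtr0_norm//.
move: sd; rewrite ltr_pdivlMr//; apply: le_lt_trans.
by rewrite ler_wpM2l ?lerDl// ltW.
Qed.

Lemma dapprox_line f p g u e : dapprox f p g -> 0 < e ->
  exists2 d : R, 0 < d & forall s : R, 0 < s -> s < d ->
    `|f (p + s *: u) - f p - s * dot g u| <= e * s.
Proof.
move=> df e0; have u0 : 0 < enorm u + 1 by rewrite ltr_wpDl// enorm_ge0.
have [d d0 H] := near_line u (df _ (divr_gt0 e0 u0)).
exists d => // s s0 sd; have := H s s0 sd.
have -> : p + s *: u - p = s *: u by rewrite addrC addKr.
rewrite dotZr enormZ (gtr0_norm s0) => /le_trans; apply.
have -> : e / (enorm u + 1) * (s * enorm u) = e * s * (enorm u / (enorm u + 1)).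
  by ring.
rewrite ler_piMr ?mulr_ge0 ?(ltW e0) ?(ltW s0)//.
by rewrite ler_pdivrMr// mul1r lerDl.
Qed.

(** Directions that enter A satisfy df(u) <= 0, since f < 0 on A near p. It is applied with w
    pointing from a foot point to the centre of a touching ball, and with w opposite to the gradient
    of another defining function. *)
Lemma defining_near_normal A p U f w : open U -> U p ->
  A `&` U = [set x | f x < 0] `&` U -> f p = 0 -> grad f p != 0 -> w != 0 ->
  dapprox f p (grad f p) ->
  (forall u, 0 < dot w u ->
     exists2 d : R, 0 < d & forall s : R, 0 < s -> s < d -> A (p + s *: u)) ->
  unit_normal f p = - ((enorm w)^-1 *: w).
Proof.
move=> oU Up AU fp g0 w0 df H; apply: halfspace_normal => // u /H[d1 d10 h1].
rewrite leNgt; apply/negP => gu.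
have [d2 d20 h2] := dapprox_line u df gu.
have [d3 d30 h3] := near_line u (open_nbhs_nbhs (conj oU Up)).
pose s := Num.min d1 (Num.min d2 d3) / 2.
have m0 : 0 < Num.min d1 (Num.min d2 d3) by rewrite !lt_min d10 d20.
have s0 : 0 < s by rewrite divr_gt0.
have : s < Num.min d1 (Num.min d2 d3) by rewrite ltr_pdivrMr// ltr_pMr ?ltr1n.
rewrite !lt_min => /and3P[s1 s2 s3].
have [] : ([set x | f x < 0] `&` U) (p + s *: u).
  by rewrite -AU; split; [exact: h1 | exact: h3].
rewrite /= => fn _; have := h2 s s0 s2; rewrite fp subr0 mulrC.
by rewrite ler_norml => /andP[]; lra.
Qed.

Lemma defining_near_bd A p U f x : defining_near A p U f -> bd A x -> U x ->
  f x = 0 /\ grad f x != 0.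
Proof.
move=> [_ _ _ bU g0] bx Ux; split; last by apply: g0.
by have [] : ([set x | f x = 0] `&` U) x by rewrite -bU.
Qed.

Lemma unit_normal_unique A p q U V f (g : 'rV[R]_m -> R) x :
  defining_near A p U f -> defining_near A q V g -> bd A x -> U x -> V x ->
  dapprox f x (grad f x) -> dapprox g x (grad g x) ->
  unit_normal f x = unit_normal g x.
Proof.
move=> df dg bx Ux Vx af ag.
have [fx gf] := defining_near_bd df bx Ux.
have [gx gg] := defining_near_bd dg bx Vx.
have [oU _ AU _ _] := df; have [oV _ AV _ _] := dg.
rewrite (@defining_near_normal A x U f (- grad g x))//.
- by rewrite enormN scalerN opprK.
- by rewrite oppr_eq0.
- move=> u; rewrite dotNl oppr_gt0 => gu.
  have gu0 : 0 < - dot (grad g x) u / 2 by rewrite divr_gt0// oppr_gt0.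
  have [d1 d10 h1] := dapprox_line u ag gu0.
  have [d2 d20 h2] := near_line u (open_nbhs_nbhs (conj oV Vx)).
  exists (Num.min d1 d2); first by rewrite lt_min d10.
  move=> s s0; rewrite lt_min => /andP[s1 s2].
  suff [] : (A `&` V) (x + s *: u) by [].
  rewrite AV; split; last exact: h2.
  have := h1 s s0 s1; rewrite gx subr0 ler_norml => /andP[_]; rewrite /= mulrC => h.
  have : s * dot (grad g x) u < 0 by rewrite pmulr_rlt0.
  by move: h; lra.
Qed.

End Normals.

(** * Distance to the exterior and reach of the boundary *)

Section Distance.
Context {R : realType} {m : nat}.
Implicit Types (x y p u v w : 'rV[R]_m) (f : 'rV[R]_m -> R) (e : R).
Implicit Types (A U : set 'rV[R]_m).

Lemma closure_enorm A x :
  closure A x <-> forall e : R, 0 < e -> exists2 y, A y & enorm (y - x) < e.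
Proof.
split=> [cA e /(near_enorm x)/cA[y [Ay yx]]|H B /near_enormP[e /H[y Ay yx] HB]].
  by exists y.
by exists y; split => //; apply: HB.
Qed.

Lemma lip1_continuous f : (forall y z, f y - f z <= enorm (y - z)) ->
  forall x, {for x, continuous f}.
Proof.
move=> lf x; apply/(@cvgrPdist_lt _ _ _ _ (nbhs_filter x)) => e e0.
apply: filterS (near_enorm x e0) => y yx; rewrite ltr_distl.
have := lf x y; have := lf y x; rewrite (enormB x y); move: yx; lra.
Qed.

Lemma bounded_set_enorm A :
  bounded_set A <-> exists M : R, forall x, A x -> enorm x <= M.
Proof.
split=> [[M [_ HM]]|[M HM]].
  exists (m%:R * (M + 1)) => x Ax; rewrite (le_trans (enorm_le_norm _))//.
  by rewrite ler_wpM2l//; apply: (HM (M + 1)) => //; rewrite ltrDl.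
exists M; split; first exact: num_real.
move=> K MK x Ax /=; rewrite (le_trans (norm_le_enorm _))//.
by rewrite (le_trans (HM _ Ax))// ltW.
Qed.

Lemma edist_lbound x A : has_lbound [set enorm (x - y) | y in A].
Proof. by exists 0 => _ [y _ <-]; exact: enorm_ge0. Qed.

Lemma edist_le x y A : A y -> edist_set x A <= enorm (x - y).
Proof. by move=> Ay; apply: ge_inf; [exact: edist_lbound|exists y]. Qed.

Lemma le_edist x A c : A !=set0 -> (forall y, A y -> c <= enorm (x - y)) ->
  c <= edist_set x A.
Proof.
move=> [a Aa] H; apply: lb_le_inf; first by exists (enorm (x - a)); exists a.
by move=> _ [y Ay <-]; exact: H.
Qed.

Lemma edist_ge0 x A : 0 <= edist_set x A.
Proof.
have [->|/set0P A0] := eqVneq A set0; last first.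
  by apply: le_edist => // y _; exact: enorm_ge0.
by rewrite /edist_set image_set0 inf0.
Qed.

Lemma edist0 x A : A x -> edist_set x A = 0.
Proof.
move=> Ax; apply/eqP; rewrite eq_le edist_ge0 andbT.
by rewrite (le_trans (edist_le x Ax))// subrr enorm0.
Qed.

Lemma edist_lip A x y : A !=set0 ->
  edist_set x A - edist_set y A <= enorm (x - y).
Proof.
move=> A0; rewrite lerBlDr -lerBlDl; apply: le_edist => // z Az.
rewrite lerBlDl (le_trans (edist_le x Az))//.
exact: enorm_dist.
Qed.

Lemma edist_attained x A : closed A -> A !=set0 ->
  exists2 y, A y & enorm (x - y) = edist_set x A.
Proof.
move=> cA [a Aa].
(* Points of A farther from x than a cannot be nearest, and the remaining set is compact. *)
pose B := A `&` [set y | enorm (x - y) <= enorm (x - a)].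
have cB : closed B.
  apply: closedI => // y /closure_enorm H /=.
  apply/ler_addgt0Pl => e e0; have [z /= za zy] := H e e0.
  rewrite (le_trans (enorm_dist x z y))// addrC lerD//; exact: ltW.
have bB : bounded_set B.
  apply/bounded_set_enorm; exists (enorm x + enorm (x - a)) => y [_ /= ya].
  have := enorm_dist (-y) (x - y) 0; rewrite !subr0 enormN.
  rewrite (_ : - y - (x - y) = - x); last by rewrite opprB addKr.
  by rewrite enormN => /le_trans; apply; rewrite lerD2l.
have cf : {within B, continuous (fun y => enorm (x - y))}.
  apply: continuous_subspaceT => y; apply: lip1_continuous => {}y z.
  have := enorm_dist x z y; rewrite (enormB z y); lra.
have B0 : B !=set0 by exists a; split => //=.
have [y] := EVT_min_rV B0 (bounded_closed_compact bB cB) cf.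
rewrite inE => -[Ay _] miny; exists y => //.
apply/eqP; rewrite eq_le edist_le// andbT; apply: le_edist; first by exists a.
move=> z Az; have [za|za] := leP (enorm (x - z)) (enorm (x - a)).
  by apply: miny; rewrite inE.
by rewrite (le_trans _ (ltW za))//; apply: miny; rewrite inE; split => /=.
Qed.

End Distance.

(** * The global normal field and a uniform constant for the touching balls *)

Section Boundary.
Context {R : realType} {m : nat}.
Implicit Types (x y p u v w : 'rV[R]_m) (f : 'rV[R]_m -> R) (e k : R).
Implicit Types (A D U V : set 'rV[R]_m).

Lemma bd_open D : open D -> bd D = closure D `\` D.
Proof. by move=> oD; rewrite /bd (interior_id _).1. Qed.

Lemma bd_compact D : bounded_set D -> open D -> compact (bd D).
Proof.
move=> bD oD; apply: bounded_closed_compact.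
  have [M HM] := (bounded_set_enorm _).1 bD.
  apply/bounded_set_enorm; exists (M + 1) => x [/closure_enorm/(_ 1 ltr01)[y Dy yx] _].
  have := HM y Dy; have := enorm_sub_le x y; rewrite (enormB x y); lra.
rewrite bd_open// setDE; apply: closedI; first exact: closed_closure.
exact: open_closedC.
Qed.

Lemma defining_near_sub A p U V f : defining_near A p U f -> open V ->
  V `<=` U -> V p -> defining_near A p V f.
Proof.
move=> [oU Up AU bU gU] oV VU Vp.
have E (B : set 'rV[R]_m) : B `&` V = B `&` U `&` V.
  by rewrite -setIA (setIidr VU).
split=> //; first by rewrite E AU -E.
  by rewrite E bU -E.
by move=> x [bx Vx]; apply: gU; split => //; exact: VU.
Qed.

Lemma defining_near_at A p U f x : defining_near A p U f -> U x ->
  defining_near A x U f.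
Proof. by case=> *; split. Qed.

Lemma Ck_on_sub (j : nat) U V f : V `<=` U -> Ck_on j U f -> Ck_on j V f.
Proof. by move=> VU H s sk x /VU; apply: H. Qed.

(** A choice among all local C^2 defining functions, which makes the normal a single global
    function; on bd D the result is independent of the choice by [unit_normal_unique]. *)
Definition outer_normal D p : 'rV[R]_m :=
  xget 0 [set v | exists U f,
    [/\ defining_near D p U f, Ck_on 2 U f & v = unit_normal f p]].

Lemma outer_normalE D p x U f : defining_near D p U f -> Ck_on 2 U f ->
  bd D x -> U x -> outer_normal D x = unit_normal f x.
Proof.
move=> df cf bx Ux; rewrite /outer_normal.
have d1 : dapprox f x (grad f x).
  have [oU _ _ _ _] := df; apply: C1_dapprox.
  by have [] := Ck_on2P oU cf Ux.
case: xgetP => [v _ [V [g [dg cg ->]]]|/(_ (unit_normal f x))[]]; last first.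
  by exists U, f; split => //; exact: defining_near_at df Ux.
have [oV Vx _ _ _] := dg.
have d2 : dapprox g x (grad g x).
  by apply: C1_dapprox; have [] := Ck_on2P oV cg Vx.
exact: unit_normal_unique dg df bx Vx Ux d2 d1.
Qed.

(* The inequality says that the exterior of D is disjoint from the ball of
   radius 1 / (2 k) which touches bd D from inside at x. *)
Definition tame D k x :=
  (forall y, ~ D y -> - k * enorm (y - x) ^+ 2 <= dot (outer_normal D x) (y - x)) /\
  exists U f, [/\ defining_near D x U f, Ck_on 2 U f &
    forall y, U y -> grad f y != 0 /\
      forall v, enorm (v *m shape f y) <= k * enorm v].

Lemma enorm_unit_normal f x : grad f x != 0 -> enorm (unit_normal f x) = 1.
Proof. by move=> g0; rewrite /enorm unit_normal_unit ?sqrtr1. Qed.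

Lemma mulmx_le (M : 'M[R]_m) v :
  enorm (v *m M) <= (\sum_j \sum_i `|M j i|) * enorm v.
Proof.
rewrite mulmx_sum_row (le_trans (enorm_sum _ _))// mulr_suml; apply: ler_sum => j _.
rewrite enormZ mulrC ler_pM ?enorm_ge0 ?coord_le//.
rewrite (le_trans (enorm_le_sum _))//.
by apply: ler_sum => i _; rewrite mxE.
Qed.

Lemma mx_continuous_bounded (M : 'rV[R]_m -> 'M[R]_m) p : mx_continuous M p ->
  exists K, \forall x \near p, forall v, enorm (v *m M x) <= K * enorm v.
Proof.
move=> cM; exists (\sum_j \sum_i (`|M p j i| + 1)).
have := near_all (fun i => near_all (fun j => near_continuous (cM i j) ltr01)).
apply: filterS => x H v; rewrite (le_trans (mulmx_le _ _))// ler_wpM2r ?enorm_ge0//.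
apply: ler_sum => i _; apply: ler_sum => j _.
rewrite -(subrK (M p i j) (M x i j)) (le_trans (ler_normD _ _))// addrC.
by rewrite lerD2l.
Qed.

(** For y outside D close to x, f(x) = 0 <= f(y) and the Taylor remainder bounds <grad f x, y - x>
    from below. For y far from x, Cauchy-Schwarz suffices once k |y - x| >= 1. *)
Lemma tame_near D p : Ck_boundary 2 D -> bd D p ->
  \forall x \near p & k \near +oo, bd D x -> tame D k x.
Proof.
move=> cD bp; have [U [f [df cf]]] := cD p bp.
have [oU Up DU _ _] := df.
have [_ c1 c2] := Ck_on2P oU cf Up.
have [fp gp] := defining_near_bd df bp Up.
have [K [e [K0 e0 tay]]] := taylor2 c1.1 c2.
have gn : 0 < enorm (grad f p) by rewrite enorm_gt0.
pose c := enorm (grad f p) / 2; have c0 : 0 < c by rewrite divr_gt0.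
have gc : \forall x \near p, c < enorm (grad f x).
  apply: (vapprox_near (grad_vapprox c2) (P := [set v | c < enorm v])).
  apply/near_enormP; exists c => // y yc /=.
  have := enorm_sub_le (grad f p) y; rewrite (enormB _ y); rewrite /c in yc *; lra.
have [K1 hK1] := mx_continuous_bounded (shape_continuous gp c2).
pose W := [set x : 'rV[R]_m | U x /\ c < enorm (grad f x) /\
  forall v, enorm (v *m shape f x) <= K1 * enorm v].
have nU : nbhs p W.
  by apply: filterI (filterI gc hK1); exact: open_nbhs_nbhs (conj oU Up).
have [d d0 hd] := (near_enormP _ _).1 nU.
pose r := Num.min e d; have r0 : 0 < r by rewrite lt_min e0.
(* The conditions in [W] hold on a neighborhood only, while the domain of a defining function has to
   be open. *)
pose V := W°.
have oV : open V by exact: open_interior.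
have VE x : V x -> _ := @interior_subset _ _ x.
have nV : \forall x \near p, V x.
  apply: open_nbhs_nbhs; split => //; exact: nU.
have nr : \forall x \near p, enorm (x - p) < r / 2.
  by apply: near_enorm; rewrite divr_gt0.
near=> x k => bx.
(* [K1] controls the shape operator, K / c the points y close to x, and 2 / r those at distance at
   least r / 2. *)
have k1 : K1 <= k by near: k; apply: nbhs_pinfty_ge; exact: num_real.
have k2 : K / c <= k by near: k; apply: nbhs_pinfty_ge; exact: num_real.
have k3 : 2 / r <= k by near: k; apply: nbhs_pinfty_ge; exact: num_real.
have Vx : V x by near: x.
have xr : enorm (x - p) < r / 2 by near: x.
have [Ux [gx hx]] := VE _ Vx.
have g0 : grad f x != 0 by rewrite -enorm_gt0 (lt_trans c0).
have N1 : outer_normal D x = unit_normal f x := outer_normalE df cf bx Ux.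
split; last first.
  exists V, f; split.
  - apply: defining_near_sub (defining_near_at df Ux) _ _ _ => //.
    by move=> y /VE[].
  - by apply: Ck_on_sub cf => y /VE[].
  - move=> y /VE[_ [gy hy]]; split=> [|v]; first by rewrite -enorm_gt0 (lt_trans c0).
    by rewrite (le_trans (hy v))// ler_wpM2r ?enorm_ge0.
move=> y Dy; rewrite N1; have n0 := enorm_ge0 (y - x).
have [yx|yx] := ltP (enorm (y - x)) (r / 2).
- have yp : enorm (y - p) < r.
    by rewrite (le_lt_trans (enorm_dist y x p))// [r]splitr ltrD.
  have re : r <= e by rewrite ge_min lexx.
  have rd : r <= d by rewrite ge_min lexx orbT.
  have xp : enorm (x - p) < r by rewrite (lt_trans xr)// ltr_pdivrMr// ltr_pMr ?ltr1n.
  have Uy : U y by have [] := hd y (lt_le_trans yp rd).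
  have fy : 0 <= f y.
    rewrite leNgt; apply/negP => fy; apply: Dy.
    by have [] : (D `&` U) y by rewrite DU.
  have [fx _] := defining_near_bd df bx Ux.
  have := tay x y (lt_le_trans xp re) (lt_le_trans yp re).
  rewrite fx subr0 ler_norml => /andP[_ T].
  have T2 : - K * enorm (y - x) ^+ 2 <= dot (grad f x) (y - x) by lra.
  have gg : 0 < enorm (grad f x) by rewrite (lt_trans c0).
  rewrite dotZl ler_pdivlMl//; apply: le_trans T2.
  rewrite mulrA ler_wpM2r ?sqr_ge0// mulrN lerN2.
  by rewrite -ler_pdivrMl// mulrC (le_trans _ k2)// ler_pM2l// lef_pV2// ltW.
- have h : - (1 * enorm (y - x)) <= dot (unit_normal f x) (y - x).
    have := dot_le (unit_normal f x) (y - x).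
    rewrite enorm_unit_normal// ler_norml.
    by case/andP.
  apply: le_trans h; rewrite mulNr lerN2 expr2 mulrA ler_wpM2r//.
  apply: le_trans (ler_pM _ _ k3 yx); rewrite ?divr_ge0 ?(ltW r0)//.
  have -> // : 2 / r * (r / 2) = 1 by field; rewrite gt_eqF.
Unshelve. all: by end_near. Qed.

Lemma tame_uniform D : open D -> bounded_set D -> Ck_boundary 2 D ->
  exists2 k, 0 < k & forall x, bd D x -> tame D k x.
Proof.
move=> oD bD cD.
have /compact_near_coveringP/near_covering_withinP cpt := bd_compact bD oD.
have H : \forall k \near +oo, bd D `<=` tame D k.
  by apply: cpt => p bp; exact: tame_near.
have Hp := nbhs_pinfty_gt (num_real (0 : R)).
have [k [k0 Hk]] := filter_ex (filterI Hp H).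
by exists k.
Qed.

End Boundary.

(** * The inner tubular neighborhood *)

(** A vector v in the kernel satisfies v = v A, hence |v| <= c |v|. *)
Lemma unitmx_contraction (R : realType) m (A : 'M[R]_m) (c : R) : c < 1 ->
  (forall v, enorm (v *m A) <= c * enorm v) -> 1%:M - A \in unitmx.
Proof.
move=> c1 H; rewrite -row_free_unit -kermx_eq0; apply/eqP/row_matrixP => i.
rewrite row0; set v := row i _.
have : v *m (1%:M - A) = 0 by rewrite -row_mul mulmx_ker row0.
rewrite mulmxBr mulmx1 => /eqP; rewrite subr_eq0 => /eqP vA.
apply/eqP; rewrite -enorm_eq0 eq_le enorm_ge0 andbT.
have := H v; rewrite -vA -subr_ge0 -{2}[enorm v]mul1r -mulrBl.
by rewrite nmulr_rge0 ?subr_lt0.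
Qed.

Lemma dot_offsets (R : realType) m (p1 p2 n1 n2 : 'rV[R]_m) (s1 s2 : R) :
  dot (p1 - s1 *: n1 - (p2 - s2 *: n2)) (p1 - p2) =
  dot (p1 - p2) (p1 - p2) + s1 * dot n1 (p2 - p1) + s2 * dot n2 (p1 - p2).
Proof.
have -> : p2 - p1 = - (p1 - p2) by rewrite opprB.
have -> : p1 - s1 *: n1 - (p2 - s2 *: n2) = p1 - p2 - s1 *: n1 + s2 *: n2.
  by apply/rowP => i; rewrite !mxE; ring.
by move: (p1 - p2) => w; rewrite 2!dotDl dotNl !dotZl dotNr mulrN.
Qed.

(** Here z is the squared distance of two foot points, and a and b are bounded below by the touching
    balls there. Each curvature term costs at most z / 4, so half of z survives; this is where 4 k
    comes from. *)
Lemma reach_arith (R : realType) (k z a b s1 s2 : R) : 0 <= z ->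
  0 < s1 -> 0 < s2 -> 4 * k * s1 < 1 -> 4 * k * s2 < 1 ->
  - k * z <= a -> - k * z <= b -> z <= 2 * (z + s1 * a + s2 * b).
Proof.
move=> z0 s10 s20 h1 h2 ha hb.
have := ler_wpM2l (ltW s10) ha; have := ler_wpM2l (ltW s20) hb.
have := ler_wpM2r z0 (ltW h1); have := ler_wpM2r z0 (ltW h2).
lra.
Qed.

(* Both estimates of the depth come from comparing the distances of q and q0
   to the two foot points, linearized by [s <= (s ^+ 2 + t ^+ 2) / (2 * t)]. *)
Lemma depth_arith (R : realType) m (h n0 n : 'rV[R]_m) (s0 s e : R) :
  0 < s0 -> 0 < s -> s0 / 2 < s ->
  s <= enorm (h - s0 *: n0) -> s0 <= enorm (h + s *: n) ->
  dot n0 n0 = 1 -> dot n n = 1 ->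
  dot n h - dot n0 h <= enorm (n - n0) * enorm h ->
  enorm (n - n0) <= e / 2 -> enorm h <= e / 2 * s0 ->
  `|s - s0 + dot n0 h| <= e * enorm h.
Proof.
move=> s00 s1 ss up lo u0 u C hn hh.
have up2 : s ^+ 2 <= enorm h ^+ 2 - 2 * s0 * dot n0 h + s0 ^+ 2.
  rewrite -ler_sqr ?nnegrE ?enorm_ge0 ?(ltW s1)// in up.
  apply: le_trans up _; rewrite !sqr_enorm dotBl !dotBr !dotZl !dotZr u0 (dotC h n0).
  lra.
have lo2 : s0 ^+ 2 <= enorm h ^+ 2 + 2 * s * dot n h + s ^+ 2.
  rewrite -ler_sqr ?nnegrE ?enorm_ge0 ?(ltW s00)// in lo.
  apply: le_trans lo _; rewrite !sqr_enorm dotDl !dotDr !dotZl !dotZr u (dotC h n).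
  lra.
have h0 := enorm_ge0 h.
have hC : dot n h - dot n0 h <= e / 2 * enorm h.
  by rewrite (le_trans C)// ler_wpM2r.
have hh2 : enorm h ^+ 2 <= e / 2 * s0 * enorm h.
  by rewrite expr2 ler_wpM2r.
have eh : 0 <= e / 2 * enorm h.
  by apply: le_trans (mulr_ge0 (enorm_ge0 (n - n0)) h0) _; rewrite ler_wpM2r.
move: (dot n0 h) (dot n h) (enorm h) up2 lo2 hC hh2 eh => a b z up2 lo2 hC hh2 eh.
clear - s00 s1 ss up2 lo2 hC hh2 eh; rewrite ler_norml; apply/andP; split.
- rewrite -(ler_pM2l s1); have := sqr_ge0 (s - s0).
  have := ler_wpM2l (ltW s1) hC.
  have := ler_wpM2r eh (ltW ss); lra.
- rewrite -(ler_pM2l s00); have := sqr_ge0 (s - s0).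
  have := mulr_ge0 (ltW s00) eh; lra.
Qed.

(** With a = <n0, q - q0> and w the image of p - p0 under the shape operator, this is the defect of
    the linearized identity q = p - s n. The right side collects the error of the depth, the error
    of the normal and a product of two increments, all negligible against |q - q0|. *)
Lemma rem_identity (R : realType) m (q q0 p p0 n n0 w : 'rV[R]_m) (s s0 a : R) :
  q = p - s *: n -> q0 = p0 - s0 *: n0 ->
  p - p0 - s0 *: w - (q - q0 - a *: n0) =
  (s - s0 + a) *: n0 + s0 *: (n - n0 - w) + (s - s0) *: (n - n0).
Proof.
by move=> -> ->; apply/rowP => i; rewrite !mxE; ring.
Qed.

Lemma near_and (R : realType) m (x : 'rV[R]_m) (P Q : 'rV[R]_m -> Prop) :
  (\forall y \near x, P y) -> (\forall y \near x, Q y) ->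
  \forall y \near x, P y /\ Q y.
Proof. exact: (@filterI _ (nbhs x)). Qed.

Lemma vapprox_subZ (R : realType) m k (F G : 'rV[R]_m -> 'rV[R]_k) x
    (M M' : 'M[R]_(m, k)) (s : R) : vapprox F x M -> vapprox G x M' ->
  vapprox (fun y => F y - s *: G y) x (M - s *: M').
Proof.
move=> /vapproxP dF /vapproxP dG; apply/vapproxP => e e0.
have e1 : 0 < e / 2 by rewrite divr_gt0.
have s1 : 0 < `|s| + 1 by rewrite ltr_wpDl.
have e2 : 0 < e / 2 / (`|s| + 1) by rewrite divr_gt0.
apply: filterS2 (dF _ e1) (dG _ e2) => y h1 h2.
have -> : F y - s *: G y - (F x - s *: G x) - (y - x) *m (M - s *: M') =
    (F y - F x - (y - x) *m M) - s *: (G y - G x - (y - x) *m M').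
  rewrite mulmxBr -scalemxAr; move: (_ *m M) (_ *m M') => a b.
  by apply/rowP => i; rewrite !mxE; ring.
rewrite (le_trans (enormD _ _))// (splitr e) mulrDl lerD// enormN enormZ.
rewrite (le_trans (ler_wpM2l (normr_ge0 s) h2))// mulrA ler_wpM2r ?enorm_ge0//.
by rewrite mulrCA ger_pMr// ler_pdivrMr// mul1r lerDl.
Qed.

Section Tube.
Context {R : realType} {m : nat}.
Implicit Types (x y p q u v w : 'rV[R]_m) (f : 'rV[R]_m -> R) (e s : R).
Variables (D : set 'rV[R]_m) (k : R).
Hypotheses (oD : open D) (D' : ~` D !=set0) (k0 : 0 < k).
Hypothesis tD : forall x, bd D x -> tame D k x.

Let N := outer_normal D.

Definition depth x := edist_set x (~` D).

(** The bound is half the radius 1 / (2 k) of the touching balls. It gives the Lipschitz bound for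
    [proj] and makes 1 - depth A invertible when |A| <= k. *)
Definition tube := [set x | 0 < depth x < (4 * k)^-1].

Definition proj q : 'rV[R]_m := xget 0 [set p | ~ D p /\ enorm (q - p) = depth q].

Lemma projP q : ~ D (proj q) /\ enorm (q - proj q) = depth q.
Proof.
rewrite /proj; case: xgetP => [p _ //|/= H].
have [p Dp qp] := edist_attained q (open_closedC oD) D'.
by case: (H p).
Qed.

Lemma depth_lip x y : depth x - depth y <= enorm (x - y).
Proof. exact: edist_lip. Qed.

Lemma depth_continuous x : {for x, continuous depth}.
Proof. exact: lip1_continuous depth_lip x. Qed.

Lemma depth_gt0 q : 0 < depth q <-> D q.
Proof.
split=> [|Dq]; first by apply: contraPP => Dq; rewrite /depth edist0// ltxx.
have [Dp <-] := projP q; rewrite enorm_gt0 subr_eq0.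
by apply/eqP => qp; apply: Dp; rewrite -qp.
Qed.

Lemma depth_ball q y : enorm (y - q) < depth q -> D y.
Proof.
move=> H; apply: contrapT => Dy.
by move: H; rewrite ltNge enormB edist_le.
Qed.

Lemma proj_bd q : D q -> bd D (proj q).
Proof.
move=> /depth_gt0 dq; have [Dp pE] := projP q.
rewrite bd_open//; split=> //; apply/closure_enorm => e e0.
have [d d0 H] := near_line (q - proj q) (near_enorm (proj q) e0).
(* A step from the foot point towards q by a fraction s < 1 enters the ball about q of radius depth
   q, which lies in D. *)
pose s := Num.min d 1 / 2.
have s0 : 0 < s by rewrite divr_gt0// lt_min d0 ltr01.
have : s < Num.min d 1 by rewrite ltr_pdivrMr// ltr_pMr ?ltr1n// lt_min d0 ltr01.
rewrite lt_min => /andP[sd s1].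
exists (proj q + s *: (q - proj q)); last exact: H.
apply: (@depth_ball q).
rewrite (_ : _ - q = (s - 1) *: (q - proj q)); last first.
  by rewrite scalerBl scale1r addrAC -opprB addrC.
rewrite enormZ pE distrC gtr0_norm ?subr_gt0//.
by rewrite gtr_pMl// ltrBlDr ltrDl.
Qed.

Lemma outer_normal_unit p : bd D p -> dot (N p) (N p) = 1.
Proof.
move=> bp; have [_ [U [f [df cf /(_ p)[]]]]] := tD bp; first by case: df.
move=> g0 _; rewrite /N (outer_normalE df cf bp); last by case: df.
exact: unit_normal_unit.
Qed.

Lemma enorm_outer_normal p : bd D p -> enorm (N p) = 1.
Proof. by move=> bp; rewrite /enorm outer_normal_unit// sqrtr1. Qed.

(** The ball about q of radius depth q lies in D and touches the boundary at proj q, so every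
    direction u with <q - proj q, u> > 0 enters D; this determines the normal. *)
Lemma proj_eq q : D q -> q = proj q - depth q *: N (proj q).
Proof.
move=> Dq; have bp := proj_bd Dq; have [Dp pE] := projP q.
have dq := (depth_gt0 q).2 Dq.
have [_ [U [f [df cf _]]]] := tD bp.
have [oU Up DU _ _] := df; have [fp gp] := defining_near_bd df bp Up.
have w0 : q - proj q != 0 by rewrite -enorm_gt0 pE.
rewrite /N (outer_normalE df cf bp Up).
rewrite (defining_near_normal oU Up DU fp gp w0).
- by rewrite pE scalerN opprK scalerA divff ?gt_eqF// scale1r addrC subrK.
- by apply: C1_dapprox; have [] := Ck_on2P oU cf Up.
(* With w = q - proj q, the point proj q + s u is in the ball as soon as s |u|^2 < 2 <w, u>; the
   added 1 keeps the denominator positive. *)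
move=> u wu; exists (dot (q - proj q) u / (dot u u + 1)) => [|s s0].
  by rewrite divr_gt0// ltr_wpDl ?dot_ge0.
have uu : 0 < dot u u + 1 by rewrite ltr_wpDl ?dot_ge0.
rewrite ltr_pdivlMr// => sd; apply: (@depth_ball q).
rewrite -ltr_sqr ?nnegrE ?enorm_ge0 ?(ltW dq)// -pE !sqr_enorm.
rewrite (_ : _ - q = s *: u - (q - proj q));
  last by rewrite opprB addrA addrAC addrC addrA.
move: (q - proj q) wu sd => w wu sd.
rewrite dotBl !dotBr !dotZl !dotZr (dotC u w).
have : s * (s * (dot u u + 1)) < s * dot w u by rewrite ltr_pM2l.
have := mulr_gt0 s0 wu; have := mulr_gt0 s0 s0.
move: (dot u u) (dot w u) (dot w w) => a b c h1 h2 h3.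
by clear - h1 h2 h3; lra.
Qed.

Lemma proj_shift q : D q -> proj q = q + depth q *: N (proj q).
Proof.
by move=> Dq; apply/eqP; rewrite -subr_eq; apply/eqP/esym; exact: proj_eq.
Qed.

(** Expanding the square turns [tame] into a quantitative form of the touching ball: for 2 k s < 1
    no exterior point is closer than s, and only y = p attains s. [depth_normal] and [proj_normal]
    read off these two facts. *)
Lemma exterior_sphere p s y : bd D p -> ~ D y -> 0 <= s ->
  s ^+ 2 + (1 - 2 * k * s) * enorm (y - p) ^+ 2 <=
    enorm (p - s *: N p - y) ^+ 2.
Proof.
move=> bp Dy s0; have [/(_ y Dy) H _] := tD bp.
rewrite (_ : p - s *: N p - y = - ((y - p) + s *: N p)); last first.
  by rewrite opprD opprB addrAC.
rewrite enormN; move: (y - p) H => w; rewrite !sqr_enorm -/N => H.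
rewrite dotDl !dotDr !dotZl !dotZr outer_normal_unit// (dotC w (N p)).
move: (dot (N p) w) (dot w w) H => a b H.
by have := ler_wpM2l s0 H; lra.
Qed.

Lemma depth_normal p s : bd D p -> 0 <= s -> 2 * k * s < 1 ->
  depth (p - s *: N p) = s.
Proof.
move=> bp s0 ks; apply/eqP; rewrite eq_le; apply/andP; split.
  have Dp : ~ D p by move: bp; rewrite bd_open// => -[].
  rewrite (le_trans (edist_le _ Dp))// addrAC subrr add0r enormN enormZ.
  by rewrite enorm_outer_normal// mulr1 ger0_norm.
apply: le_edist => // y Dy.
rewrite -ler_sqr ?nnegrE ?enorm_ge0//.
apply: le_trans (exterior_sphere bp Dy s0).
by rewrite lerDl mulr_ge0 ?sqr_ge0// subr_ge0 ltW.
Qed.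

Lemma proj_normal p s : bd D p -> 0 <= s -> 2 * k * s < 1 ->
  proj (p - s *: N p) = p.
Proof.
move=> bp s0 ks; set q := p - _; have [Dp pE] := projP q.
have := exterior_sphere bp Dp s0; rewrite -/q pE depth_normal//.
rewrite gerDl pmulr_rle0 ?subr_gt0// => h.
have : enorm (proj q - p) ^+ 2 == 0 by rewrite eq_le h sqr_ge0.
by rewrite sqrf_eq0 enorm_eq0 subr_eq0 => /eqP.
Qed.

Lemma tube_sub q : tube q -> D q.
Proof. by case/andP => /depth_gt0. Qed.

Lemma tube_small q : tube q -> 4 * k * depth q < 1.
Proof.
case/andP => _ h; rewrite mulrC -ltr_pdivlMr ?mulr_gt0//.
by rewrite div1r.
Qed.

Lemma tube_open : open tube.
Proof.
rewrite openE => x /andP[x1 x2].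
have h1 : \forall y \near x, 0 < depth y.
  by apply: (cvgr_gt _ (@depth_continuous x)).
have h2 : \forall y \near x, depth y < (4 * k)^-1.
  by apply: (cvgr_lt _ (@depth_continuous x)).
by apply: filterS2 h1 h2 => y a b; apply/andP.
Qed.

Lemma proj_lip q1 q2 : tube q1 -> tube q2 ->
  enorm (proj q1 - proj q2) <= 2 * enorm (q1 - q2).
Proof.
move=> t1 t2; have [D1 D2] := (tube_sub t1, tube_sub t2).
have [E1 E2] := (proj_eq D1, proj_eq D2).
have [s1 s2] := (tube_small t1, tube_small t2).
have [b1 b2] := (proj_bd D1, proj_bd D2).
have [/(_ _ (projP q2).1) H1 _] := tD b1.
have [/(_ _ (projP q1).1) H2 _] := tD b2.
have d1 := (depth_gt0 q1).2 D1; have d2 := (depth_gt0 q2).2 D2.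
set p1 := proj q1 in E1 H1 H2 *; set p2 := proj q2 in E2 H1 H2 *.
have [->|] := eqVneq (p1 - p2) 0.
  by rewrite enorm0 mulr_ge0// enorm_ge0.
rewrite -enorm_gt0 => n0.
have C := dot_ler (q1 - q2) (p1 - p2).
rewrite enormB -/N in H1; rewrite -/N in H2.
rewrite -(ler_pM2r n0) -expr2.
have E : dot (q1 - q2) (p1 - p2) = enorm (p1 - p2) ^+ 2 +
    depth q1 * dot (N p1) (p2 - p1) + depth q2 * dot (N p2) (p1 - p2).
  by rewrite {1}E1 {1}E2 sqr_enorm dot_offsets.
(* Strong monotonicity, |p1 - p2|^2 <= 2 <q1 - q2, p1 - p2>; Cauchy-Schwarz and one cancelled factor
   give the Lipschitz bound. *)
apply: le_trans (reach_arith (sqr_ge0 _) d1 d2 s1 s2 H1 H2) _.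
by rewrite -E -mulrA ler_pM2l.
Qed.

Lemma tube_pos q : tube q -> 0 < depth q.
Proof. by case/andP. Qed.

Lemma near_tube q : tube q -> \forall x \near q, tube x.
Proof. by move=> tq; exact: open_nbhs_nbhs (conj tube_open tq). Qed.

Lemma near_proj q (P : set 'rV[R]_m) : tube q -> nbhs (proj q) P ->
  \forall x \near q, P (proj x).
Proof.
move=> tq nP.
have L : \forall x \near q, enorm (proj x - proj q) <= 2 * enorm (x - q).
  by apply: filterS (near_tube tq) => x tx; exact: proj_lip.
exact: near_lip (ltr0Sn R 1) L nP.
Qed.

Lemma proj_continuous q : tube q -> {for q, continuous proj}.
Proof. by move=> tq P; exact: near_proj. Qed.

(** Unlike [defining_near] it names no base point, so one chart serves the feet of all q near q0. *)
Definition chart (U : set 'rV[R]_m) f :=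
  [/\ open U, Ck_on 2 U f, forall x, bd D x -> U x -> N x = unit_normal f x &
    forall y, U y -> grad f y != 0 /\
      forall v, enorm (v *m shape f y) <= k * enorm v].

Lemma chart_ex p : bd D p -> exists U f, [/\ chart U f, U p & defining_near D p U f].
Proof.
move=> bp; have [_ [U [f [df cf H]]]] := tD bp.
have [oU Up _ _ _] := df; exists U, f; split => //; split=> // x bx Ux.
exact: outer_normalE df cf bx Ux.
Qed.

(** * Differentials of the depth, the foot point map and the normal field along it *)

Section Differentiability.
Variables (q0 : 'rV[R]_m) (U : set 'rV[R]_m) (f : 'rV[R]_m -> R).
Hypotheses (tq0 : tube q0) (cf : chart U f) (Up0 : U (proj q0)).

Lemma near_chart : \forall q \near q0, tube q /\ U (proj q).
Proof.
have [oU _ _ _] := cf.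
apply: filterI (near_tube tq0) (near_proj tq0 _).
exact: open_nbhs_nbhs (conj oU Up0).
Qed.

Lemma near_normal : \forall q \near q0, N (proj q) = unit_normal f (proj q).
Proof.
have [_ _ H _] := cf.
by apply: filterS near_chart => q [tq Uq]; apply: H => //; apply/proj_bd/tube_sub.
Qed.

Lemma chart_normal_vapprox :
  vapprox (unit_normal f) (proj q0) (shape f (proj q0)).
Proof.
have [oU ck _ /(_ _ Up0)[g0 _]] := cf.
by apply: unit_normal_vapprox => //; have [] := Ck_on2P oU ck Up0.
Qed.

Lemma near_normal_increment e : 0 < e -> \forall q \near q0,
  enorm (N (proj q) - N (proj q0) - (proj q - proj q0) *m shape f (proj q0)) <=
  e * enorm (q - q0).
Proof.
(* Half of e, because [proj] has Lipschitz constant 2. *)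
move=> e0; have e2 : 0 < e / 2 by rewrite divr_gt0.
have H := near_proj tq0 ((vapproxP _ _ _).1 chart_normal_vapprox _ e2).
have E0 := nbhs_singleton near_normal.
have := near_and H (near_and near_normal (near_tube tq0)).
apply: filterS => q [h [Eq tq]]; rewrite Eq E0 (le_trans h)//.
rewrite (le_trans (ler_wpM2l (ltW e2) (proj_lip tq tq0)))//.
by rewrite mulrA divfK.
Qed.

Lemma near_normal_close e : 0 < e ->
  \forall q \near q0, enorm (N (proj q) - N (proj q0)) <= e.
Proof.
move=> e0; have E0 := nbhs_singleton near_normal.
have H := near_proj tq0 (vapprox_near chart_normal_vapprox (near_enorm _ e0)).
have := near_and H near_normal.
by apply: filterS => q [/ltW h Eq]; rewrite Eq E0.
Qed.

(** Only closeness of the normals at the feet of q and q0 is used, so this can precede the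
    differentiability of [proj], whose proof depends on it. *)
Lemma depth_dapprox : dapprox depth q0 (- N (proj q0)).
Proof.
move=> e e0; have s0 := tube_pos tq0.
have e2 : 0 < e / 2 by rewrite divr_gt0.
have hs : 0 < e / 2 * depth q0 by rewrite mulr_gt0.
have hd : \forall q \near q0, depth q0 / 2 < depth q.
  apply: (cvgr_gt _ (@depth_continuous q0)).
  by rewrite ltr_pdivrMr// ltr_pMr// ltr1n.
have := near_and (near_and (near_normal_close e2) (near_enorm q0 hs))
  (near_and hd (near_tube tq0)).
apply: filterS => q [[hN hh] [{}hd tq]].
have b0 := proj_bd (tube_sub tq0); have bq := proj_bd (tube_sub tq).
have sq := tube_pos tq.
have up : depth q <= enorm (q - proj q0) := edist_le _ (projP q0).1.
have lo : depth q0 <= enorm (q0 - proj q) := edist_le _ (projP q).1.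
have upE : q - proj q0 = (q - q0) - depth q0 *: N (proj q0).
  rewrite {1}(proj_shift (tube_sub tq0)); move: (depth q0 *: _) => v.
  by rewrite opprD addrA.
have loE : q0 - proj q = - ((q - q0) + depth q *: N (proj q)).
  rewrite {1}(proj_shift (tube_sub tq)); move: (depth q *: _) => v.
  by rewrite [in RHS]opprD opprB opprD addrA.
rewrite upE in up; rewrite loE enormN in lo.
have n1 := outer_normal_unit b0; have n2 := outer_normal_unit bq.
have C := dot_ler (N (proj q) - N (proj q0)) (q - q0).
rewrite dotBl in C.
rewrite dotNl (opprK (dot _ _)).
exact: (depth_arith s0 sq hd up lo n1 n2 C hN (ltW hh)).
Qed.

Definition dproj q : 'M[R]_m :=
  (1%:M - (unit_normal f (proj q))^T *m unit_normal f (proj q)) *m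
  invmx (1%:M - depth q *: shape f (proj q)).

Lemma chart_unitmx q : tube q -> U (proj q) ->
  1%:M - depth q *: shape f (proj q) \in unitmx.
Proof.
move=> tq Uq; have [_ _ _ /(_ _ Uq)[_ H]] := cf.
apply: (@unitmx_contraction _ _ _ (depth q * k)).
  have := tube_small tq; have := mulr_gt0 k0 (tube_pos tq); lra.
move=> v; rewrite -scalemxAr enormZ gtr0_norm ?tube_pos// -mulrA.
by rewrite ler_pM2l ?tube_pos.
Qed.

Lemma proj_vapprox : vapprox proj q0 (dproj q0).
Proof.
have uB := chart_unitmx tq0 Up0.
have E0 := nbhs_singleton near_normal.
have s0 := tube_pos tq0.
apply/vapproxP => e e0.
have [C C0 HC] := mulmx_bound (invmx (1%:M - depth q0 *: shape f (proj q0))).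
(* C pays for the inverse matrix and 3 for the three error terms; [e2] also divides by the depth
   that multiplies the error of the normal. *)
have e1 : 0 < e / C / 3 by rewrite !divr_gt0.
have e2 : 0 < e / C / 3 / depth q0 by rewrite divr_gt0.
have := near_and (near_and (depth_dapprox e1) (near_normal_increment e2))
  (near_and (near_normal_close e1) (near_tube tq0)).
apply: filterS => q [[h1 h2] [h3 tq]].
have b0 := proj_bd (tube_sub tq0).
rewrite dotNl (opprK (dot _ _)) in h1.
set rem := (proj q - proj q0) *m (1%:M - depth q0 *: shape f (proj q0)) -
  (q - q0) *m (1%:M - (unit_normal f (proj q0))^T *m unit_normal f (proj q0)).
have -> : proj q - proj q0 - (q - q0) *m dproj q0 =
    rem *m invmx (1%:M - depth q0 *: shape f (proj q0)).
  by rewrite /rem [in RHS]mulmxBl mulmxK// /dproj mulmxA.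
rewrite (le_trans (HC _))// -ler_pdivlMl// mulrA (mulrC _ e).
have -> : rem = (depth q - depth q0 + dot (N (proj q0)) (q - q0)) *: N (proj q0) +
    depth q0 *: (N (proj q) - N (proj q0) - (proj q - proj q0) *m shape f (proj q0)) +
    (depth q - depth q0) *: (N (proj q) - N (proj q0)).
  rewrite /rem -E0 2![in LHS]mulmxBr !mulmx1 mulmxA mulmx_tr_dot mul_scalar_mx -scalemxAr
    (dotC (N _)).
  exact: rem_identity (proj_eq (tube_sub tq)) (proj_eq (tube_sub tq0)).
have -> : e / C * enorm (q - q0) = e / C / 3 * enorm (q - q0) +
    e / C / 3 * enorm (q - q0) + e / C / 3 * enorm (q - q0).
  by field; rewrite gt_eqF.
rewrite (le_trans (enormD _ _))// lerD//; last first.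
  rewrite enormZ mulrC ler_pM ?enorm_ge0// ler_norml.
  have := depth_lip q q0; have := depth_lip q0 q; rewrite (enormB q0 q); lra.
rewrite (le_trans (enormD _ _))// lerD//.
  by rewrite enormZ enorm_outer_normal// mulr1.
rewrite enormZ gtr0_norm// mulrC -ler_pdivlMr//.
by rewrite (le_trans h2)// mulrAC.
Qed.

Lemma normal_proj_vapprox :
  vapprox (fun q => N (proj q)) q0 (dproj q0 *m shape f (proj q0)).
Proof.
apply: vapprox_near_eq (vapprox_comp proj_vapprox chart_normal_vapprox).
by apply: filterS near_normal => q ->.
Qed.

(** These entries are the second partials of s - depth near q0, so their continuity is the last
    ingredient of C^2 regularity. *)
Lemma normal_proj_differential_continuous : mx_continuous (fun q => dproj q *m shape f (proj q)) q0.
Proof.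
have [oU ck _ /(_ _ Up0)[g0 _]] := cf.
have [_ _ c2] := Ck_on2P oU ck Up0.
have cp := proj_continuous tq0.
have cA := mx_continuous_comp cp (shape_continuous g0 c2).
have cu : mx_continuous (unit_normal f) (proj q0).
  by move=> i j; rewrite (ord1 i); exact: dapprox_continuous (chart_normal_vapprox j).
have cn := mx_continuous_comp cp cu.
apply: mx_continuous_mul => //; apply: mx_continuous_mul.
  apply: mx_continuous_sub; first by move=> i j; exact: cst_continuous.
  by apply: mx_continuous_mul => //; exact: mx_continuous_tr.
apply: mx_continuous_inv.
  apply: mx_continuous_sub; first by move=> i j; exact: cst_continuous.
  by apply: mx_continuous_scale => //; exact: depth_continuous.
by apply: filterS near_chart => q [tq Uq]; exact: chart_unitmx.
Qed.

End Differentiability.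

Lemma depth_derive q v : tube q -> is_derive q v depth (- dot (N (proj q)) v).
Proof.
move=> tq; have [U [f [cf Up _]]] := chart_ex (proj_bd (tube_sub tq)).
by rewrite -dotNl; apply: dapprox_is_derive; exact: depth_dapprox cf Up.
Qed.

Lemma level_derive s q i : tube q ->
  is_derive q (basis_vec i) (fun x => s - depth x) (N (proj q) 0 i).
Proof.
move=> tq; have := is_deriveB (is_derive_cst s q (basis_vec i))
  (depth_derive (basis_vec i) tq).
by rewrite sub0r (opprK (dot _ _)) dot_basis.
Qed.

Lemma grad_level s q : tube q -> grad (fun x => s - depth x) q = N (proj q).
Proof.
by move=> tq; apply/rowP => i; rewrite mxE; have [_] := level_derive s i tq.
Qed.

Lemma near_level_derive s q i : tube q ->
  \forall x \near q, 'D_(basis_vec i) (fun x => s - depth x) x = N (proj x) 0 i.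
Proof.
move=> /near_tube; apply: filterS => x tx.
by have [_] := level_derive s i tx.
Qed.

Lemma level_derive2 s q U f i j : tube q -> chart U f -> U (proj q) ->
  is_derive q (basis_vec j) ('D_(basis_vec i) (fun x => s - depth x))
    ((dproj f q *m shape f (proj q)) j i).
Proof.
move=> tq cf Up.
apply: (near_eq_is_derive (f := fun x => N (proj x) 0 i)).
  by apply: filterS (near_level_derive s i tq) => x ->.
have := dapprox_is_derive (basis_vec j) (normal_proj_vapprox tq cf Up i).
by rewrite dot_basis !mxE.
Qed.

Lemma level_Ck2 s : Ck_on 2 tube (fun x => s - depth x).
Proof.
move=> ks.
(* Orders 0, 1 and 2: the function, the components of N o proj, and the entries of the differential
   of N o proj. *)
case: ks => [|i [|j [|l ks]]] //= _ q tq.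
- split=> [|_ i]; last by have [] := level_derive s i tq.
  apply: lip1_continuous => {tq}q x.
  by rewrite opprB addrC addrA subrK enormB; exact: depth_lip.
- have [U [f [cf Up _]]] := chart_ex (proj_bd (tube_sub tq)).
  split=> [|_ j]; last by have [] := level_derive2 s i j tq cf Up.
  apply: (near_eq_continuous (f1 := fun x => N (proj x) 0 i)).
    by apply: filterS (near_level_derive s i tq) => x ->.
  exact: dapprox_continuous (normal_proj_vapprox tq cf Up i).
- have [U [f [cf Up _]]] := chart_ex (proj_bd (tube_sub tq)).
  split=> //.
  apply: (near_eq_continuous (f1 := fun x => (dproj f x *m shape f (proj x)) i j)).
    apply: filterS (near_chart tq cf Up) => x [tx Ux].
    by have [_] := level_derive2 s j i tx cf Ux.
  exact: normal_proj_differential_continuous tq cf Up i j.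
Qed.

(** * Superlevel sets of the depth: boundary, connectedness and normals *)

Definition superlevel s := [set x | s < depth x].

Lemma superlevel_open s : open (superlevel s).
Proof.
rewrite openE => x sx.
by apply: (cvgr_gt _ (@depth_continuous x)).
Qed.

Lemma tube_level s q : 0 < s -> s < (4 * k)^-1 -> depth q = s -> tube q.
Proof. by move=> s0 s1 qs; apply/andP; rewrite qs. Qed.

Lemma small_radius s : s < (4 * k)^-1 -> 2 * k * s < 1.
Proof.
move=> h; have : s * (4 * k) < 1 by rewrite -ltr_pdivlMr ?mulr_gt0// div1r.
have [s0|s0] := leP s 0; last by have := mulr_gt0 k0 s0; lra.
by move=> _; have := mulr_ge0_le0 (ltW k0) s0; lra.
Qed.

Lemma bd_superlevel s q : 0 < s -> s < (4 * k)^-1 ->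
  bd (superlevel s) q <-> depth q = s.
Proof.
move=> s0 s1; rewrite (bd_open (@superlevel_open s)); split.
  move=> [/closure_enorm cq nq]; apply/eqP; rewrite eq_le; apply/andP; split.
    by rewrite leNgt; apply/negP.
  apply/ler_addgt0Pl => e e0; have [y sy yq] := cq e e0.
  have := depth_lip y q; move: sy yq; rewrite /superlevel /=; lra.
move=> qs; split; last by rewrite /superlevel /= qs ltxx.
have tq := tube_level s0 s1 qs; have Dq := tube_sub tq.
have bp := proj_bd Dq.
apply/closure_enorm => e e0.
(* Moving inwards by d along the normal raises the depth to s + d; d < e keeps the point near q, and
   s + d < (4 k)^-1 keeps [depth_normal] applicable. *)
pose d := Num.min e ((4 * k)^-1 - s) / 2.
have m0 : 0 < Num.min e ((4 * k)^-1 - s) by rewrite lt_min e0 subr_gt0.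
have d0 : 0 < d by rewrite divr_gt0.
have : d < Num.min e ((4 * k)^-1 - s) by rewrite ltr_pdivrMr// ltr_pMr ?ltr1n.
rewrite lt_min => /andP[de]; rewrite ltrBrDl => ds.
exists (proj q - (s + d) *: N (proj q)).
  rewrite /superlevel /= depth_normal//; first by rewrite ltrDl.
    by rewrite addr_ge0// ltW.
  exact: small_radius.
have -> : proj q - (s + d) *: N (proj q) - q = - (d *: N (proj q)).
  rewrite {1}(proj_shift Dq) qs; move: (N (proj q)) => n.
  by apply/rowP => i; rewrite !mxE; ring.
by rewrite enormN enormZ enorm_outer_normal// mulr1 gtr0_norm.
Qed.

Lemma level_defining s q : 0 < s -> s < (4 * k)^-1 -> depth q = s ->
  defining_near (superlevel s) q tube (fun x => s - depth x).
Proof.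
move=> s0 s1 qs; split.
- exact: tube_open.
- exact: tube_level qs.
- by apply/seteqP; split=> x [] a b; split=> //; move: a;
    rewrite /superlevel /= subr_lt0.
- apply/seteqP; split=> x [/= a b]; split=> //.
    by rewrite /= ((bd_superlevel x s0 s1).1 a) subrr.
  by apply/(bd_superlevel x s0 s1); apply/esym/eqP; rewrite -subr_eq0; apply/eqP.
- move=> x [_ tx]; rewrite grad_level// -enorm_gt0.
  by rewrite enorm_outer_normal ?ltr01//; apply/proj_bd/tube_sub.
Qed.

(** Truncation at 0 makes this the identity at depth at least s, where [proj] may be
    discontinuous. *)
Definition retract s x : 'rV[R]_m := x - Num.max 0 (s - depth x) *: N (proj x).

Lemma retract_image s : 0 < s -> s < (4 * k)^-1 ->
  retract s @` D = [set x | s <= depth x].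
Proof.
move=> s0 s1; apply/seteqP; split=> [_ [x Dx <-]|x /= sx]; last first.
  exists x; first by apply/depth_gt0; exact: lt_le_trans s0 sx.
  by rewrite /retract max_l ?scale0r ?subr0// subr_le0.
rewrite /= /retract; have [sx|sx] := leP s (depth x).
  by rewrite max_l ?scale0r ?subr0// subr_le0.
rewrite max_r; last by rewrite subr_ge0 ltW.
have -> : x - (s - depth x) *: N (proj x) = proj x - s *: N (proj x).
  rewrite {2}(proj_shift Dx); move: (N (proj x)) (depth x) => n d.
  by apply/rowP => i; rewrite !mxE; ring.
rewrite depth_normal//; [exact: proj_bd | exact: ltW | exact: small_radius].
Qed.

Lemma retract_continuous s x : s < (4 * k)^-1 -> D x ->
  {for x, continuous (retract s)}.
Proof.
move=> s1 Dx; have [sx|sx] := ltP s (depth x).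
  have E : \forall y \near x, y = retract s y.
    have : \forall y \near x, s < depth y.
      exact: (open_nbhs_nbhs (conj (@superlevel_open s) sx)).
    apply: filterS => y sy.
    by rewrite /retract max_l ?scale0r ?subr0// subr_le0 ltW.
  move=> P; rewrite /= -(nbhs_singleton E) => nP.
  by apply: filterS2 E nP => y Ey Py; rewrite /preimage /= -Ey.
have tx : tube x.
  by apply/andP; split; [exact/depth_gt0 | exact: le_lt_trans s1].
have [U [f [cf Up _]]] := chart_ex (proj_bd Dx).
have cN : {for x, continuous (fun y => N (proj y))}.
  by move=> P; apply: vapprox_near (normal_proj_vapprox tx cf Up).
have cm : {for x, continuous (fun y => Num.max 0 (s - depth y))}.
  apply: lip1_continuous => y z; have := depth_lip z y; rewrite enormB.
  have := enorm_ge0 (y - z).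
  by rewrite !maxEle; case: ifPn; case: ifPn; rewrite -?ltNge; lra.
have H : (fun y => y - Num.max 0 (s - depth y) *: N (proj y)) y @[y --> nbhs x]
  --> x - Num.max 0 (s - depth x) *: N (proj x).
  apply: cvgB; first exact: cvg_id.
  by apply: cvgZ; [exact: cm | exact: cN].
exact: H.
Qed.

(** The retraction yields closed superlevel sets; the open one is the union of those at levels r
    slightly above s, all of which contain x0. *)
Lemma superlevel_connected s x0 : connected D -> 0 < s -> s < (4 * k)^-1 ->
  s < depth x0 -> connected (superlevel s).
Proof.
move=> cD s0 s1 sx0.
have -> : superlevel s = \bigcup_(r in [set r | [/\ s < r, r < (4 * k)^-1 &
    r <= depth x0]]) [set x | r <= depth x].
  apply/seteqP; split=> [x sx|x [r [sr _ _]] /=]; last exact: lt_le_trans.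
  (* The level used for x is the midpoint of s and [M]. *)
  pose M := Num.min (depth x) (Num.min (4 * k)^-1 (depth x0)).
  have sM : s < M by rewrite !lt_min s1 sx0 /=; move: sx; rewrite /superlevel /= => ->.
  have rM : (s + M) / 2 < M by rewrite ltr_pdivrMr// mulr_natr mulr2n ltrD2r.
  have : M <= M by [].
  rewrite {2}/M !le_min => /and3P[M1 M2 M3].
  exists ((s + M) / 2); last by rewrite /=; exact: le_trans (ltW rM) M1.
  split; last exact: le_trans (ltW rM) M3.
    by rewrite ltr_pdivlMr// mulr_natr mulr2n ltrD2l.
  exact: lt_le_trans rM M2.
apply: bigcup_connected.
  by exists x0 => r [].
move=> r [sr r1 _]; rewrite -retract_image//; last exact: lt_trans sr.
apply: connected_continuous_connected => //.
apply: continuous_in_subspaceT => x; rewrite inE => Dx.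
exact: retract_continuous.
Qed.

(* The map P x = proj x - s *: N (proj x) retracts a neighborhood of q onto the
   level set of depth s, and its differential fixes the tangent vectors; both
   normal fields therefore have the same tangential derivatives at q. *)
Lemma level_normal s q f V g U u : 0 < s -> s < (4 * k)^-1 -> depth q = s ->
  defining_near (superlevel s) q V f -> Ck_on 2 V f ->
  chart U g -> U (proj q) ->
  unit_normal f q = N (proj q) /\
  (dot (N (proj q)) u = 0 ->
   u *m shape f q = u *m (dproj g q *m shape g (proj q)) /\
   u *m dproj g q - s *: (u *m dproj g q *m shape g (proj q)) = u).
Proof.
move=> s0 s1 qs df cf cg Up.
have [oV Vq _ _ _] := df.
have tq := tube_level s0 s1 qs; have bp := proj_bd (tube_sub tq).
have bq : bd (superlevel s) q by apply/bd_superlevel.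
have [_ c1 c2] := Ck_on2P oV cf Vq.
have [_ gq] := defining_near_bd df bq Vq.
have nE x : tube x -> bd (superlevel s) x -> V x -> unit_normal f x = N (proj x).
  move=> tx bx Vx; have [_ c1x _] := Ck_on2P oV cf Vx.
  have [_ c1d _] := Ck_on2P tube_open (@level_Ck2 s) tx.
  rewrite (unit_normal_unique df (level_defining s0 s1 qs) bx Vx tx
    (C1_dapprox c1x) (C1_dapprox c1d)).
  rewrite /unit_normal (grad_level s tx) enorm_outer_normal.
    by rewrite invr1 scale1r.
  by apply/proj_bd/tube_sub.
split; first exact: nE.
move=> uN.
have dP : vapprox (fun x => proj x - s *: N (proj x)) q
    (dproj g q - s *: (dproj g q *m shape g (proj q))).
  exact: vapprox_subZ (proj_vapprox tq cg Up) (normal_proj_vapprox tq cg Up).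
have Pq : proj q - s *: N (proj q) = q.
  by rewrite -[in s *: _]qs -proj_eq//; exact: tube_sub.
have dF : vapprox (unit_normal f) (proj q - s *: N (proj q)) (shape f q).
  by rewrite Pq; exact: unit_normal_vapprox.
have dFP := vapprox_comp dP dF.
have E : \forall x \near q,
    (unit_normal f \o (fun x => proj x - s *: N (proj x))) x = N (proj x).
  have nV : \forall x \near q, V (proj x - s *: N (proj x)).
    by apply: (vapprox_near dP); rewrite Pq; exact: open_nbhs_nbhs (conj oV Vq).
  apply: filterS2 (near_tube tq) nV => x tx Vx /=.
  have bx := proj_bd (tube_sub tx).
  have dx : depth (proj x - s *: N (proj x)) = s.
    by rewrite depth_normal//; [exact: ltW | exact: small_radius].
  rewrite (nE _ (tube_level s0 s1 dx) ((bd_superlevel _ s0 s1).2 dx) Vx).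
  by rewrite (proj_normal bx (ltW s0) (small_radius s1)).
have [_ D1] := vapprox_is_derive u (vapprox_near_eq E dFP).
have [_ D2] := vapprox_is_derive u (normal_proj_vapprox tq cg Up).
have [_ _ nU _] := cg.
(* The inverse in [dproj] cancels 1 - s A, leaving the tangential projection, which fixes u. *)
have uW : u *m (dproj g q - s *: (dproj g q *m shape g (proj q))) = u.
  have -> : dproj g q - s *: (dproj g q *m shape g (proj q)) =
      dproj g q *m (1%:M - depth q *: shape g (proj q)).
    by rewrite [in RHS]mulmxBr mulmx1 -scalemxAr qs.
  rewrite /dproj (mulmxKV (chart_unitmx cg tq Up)).
  rewrite mulmxBr mulmx1 mulmxA mulmx_tr_dot -nU// dotC uN.
  by rewrite mul_scalar_mx scale0r subr0.
split; last by move: uW; rewrite mulmxBr -scalemxAr (mulmxA u (dproj g q)).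
by rewrite -D2 D1 (mulmxA u _ (shape f q)) uW.
Qed.

End Tube.

(** * Sectional curvatures on complex lines *)

Section SecondForm.
Context {R : realType} {m : nat}.
Implicit Types (p q u v w e : 'rV[R]_m) (f : 'rV[R]_m -> R).
Implicit Types (L : {vspace 'rV[R]_m}) (A : 'M[R]_m).

Definition form A u v : R := dot (u *m A) v.

Lemma second_formE f p : C1_at f p -> (forall i, C1_at ('D_(basis_vec i) f) p) ->
  grad f p != 0 -> second_form f p = form (shape f p).
Proof.
move=> c1 c2 g0; apply/funext => u; apply/funext => v; rewrite /second_form.
have [_ H] := is_deriveN (vapprox_is_derive u (unit_normal_vapprox g0 c2)).
rewrite (_ : inner_normal f = - unit_normal f); last exact/funext.
by rewrite H dotNl opprK.
Qed.

Definition onb L e1 e2 :=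
  [/\ e1 \in L, e2 \in L & [/\ dot e1 e1 = 1, dot e2 e2 = 1 & dot e1 e2 = 0]].

Lemma onb_decomp L e1 e2 v : \dim L = 2%N -> onb L e1 e2 -> v \in L ->
  v = dot v e1 *: e1 + dot v e2 *: e2.
Proof.
move=> dL [L1 L2 [n1 n2 n12]] Lv.
have e1n : e1 != 0.
  by apply/eqP => e0; move: n1; rewrite e0 dot0l => /esym/eqP; rewrite oner_eq0.
have e2n : e2 != 0.
  by apply/eqP => e0; move: n2; rewrite e0 dot0l => /esym/eqP; rewrite oner_eq0.
have LE : (<[e1]> + <[e2]>)%VS = L.
  apply/eqP; rewrite eqEdim subv_add -!memvE L1 L2 /= dimv_disjoint_sum.
    by rewrite !dim_vline e1n e2n dL.
  apply/eqP; rewrite -subv0; apply/subvP => w; rewrite memv_cap memv0.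
  case/andP => /vlineP[a ->] /vlineP[b E].
  have : dot (a *: e1) e1 = 0 by rewrite E dotZl dotC n12 mulr0.
  by rewrite dotZl n1 mulr1 => ->; rewrite scale0r.
move: Lv; rewrite -LE => /memv_addP[_ /vlineP[a ->] [_ /vlineP[b ->] ->]].
by rewrite !dotDl !dotZl n1 n2 (dotC e2) n12 !mulr0 !mulr1 addr0 add0r.
Qed.

Lemma onb_parseval L e1 e2 v : \dim L = 2%N -> onb L e1 e2 -> v \in L ->
  dot v v = dot v e1 ^+ 2 + dot v e2 ^+ 2.
Proof.
move=> dL oL Lv; rewrite {2}(onb_decomp dL oL Lv) dotDr !dotZr.
by rewrite -!expr2.
Qed.

(** The form is diagonal in the eigenbasis, and Parseval for each eigenvector in the basis e1, e2
    sums its squared coefficients to 1. *)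
Lemma eigenvalues_trace A L l e1 e2 : \dim L = 2%N ->
  is_eigenvalues (form A) L l -> onb L e1 e2 ->
  form A e1 e1 + form A e2 e2 = l.1 + l.2.
Proof.
move=> dL [_ [a1 [a2 [L1 L2 na H1 H2]]]] oe.
have oa : onb L a1 a2 by split.
have [Le1 Le2 _] := oe; have [n1 n2 _] := na.
have Q v : v \in L -> form A v v = l.1 * dot v a1 ^+ 2 + l.2 * dot v a2 ^+ 2.
  move=> Lv; rewrite {1}(onb_decomp dL oa Lv) /form mulmxDl -!scalemxAl dotDl !dotZl.
  have := H1 v Lv; have := H2 v Lv; rewrite /form => -> ->.
  by rewrite (dotC a1) (dotC a2); ring.
have P1 := onb_parseval dL oe L1; have P2 := onb_parseval dL oe L2.
rewrite n1 !(dotC a1) in P1; rewrite n2 !(dotC a2) in P2.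
rewrite !Q// -[in RHS](mulr1 l.1) -[in RHS](mulr1 l.2) {1}P1 P2.
ring.
Qed.

Lemma eigenvalues_form0 A L l : is_eigenvalues (form A) L l ->
  (forall v, v \in L -> v *m A = 0) -> l.1 * l.2 = 0.
Proof.
move=> [_ [a1 [a2 [L1 L2 [n1 _ _] H1 _]]]] A0.
by have := H1 a1 L1; rewrite /form A0// dot0l n1 mulr1 => <-; rewrite mul0r.
Qed.

Lemma is_eigenvalues_pair A L e1 e2 x1 x2 (l1 l2 : R) : \dim L = 2%N ->
  onb L e1 e2 -> x1 \in L -> x2 \in L -> x1 != 0 -> x2 != 0 -> dot x1 x2 = 0 ->
  l1 <= l2 ->
  form A x1 e1 = l1 * dot x1 e1 -> form A x1 e2 = l1 * dot x1 e2 ->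
  form A x2 e1 = l2 * dot x2 e1 -> form A x2 e2 = l2 * dot x2 e2 ->
  is_eigenvalues (form A) L (l1, l2).
Proof.
move=> dL oe L1 L2 x10 x20 x12 l12 h11 h12 h21 h22; split=> //.
have nrm x : x != 0 -> dot ((enorm x)^-1 *: x) ((enorm x)^-1 *: x) = 1.
  move=> x0; rewrite dotZl dotZr -sqr_enorm mulrA -expr2 -exprMn mulVf ?expr1n//.
  by rewrite enorm_eq0.
have ext x c v : form A x e1 = c * dot x e1 -> form A x e2 = c * dot x e2 ->
    v \in L -> form A ((enorm x)^-1 *: x) v = c * dot ((enorm x)^-1 *: x) v.
  move=> E1 E2 Lv; rewrite (onb_decomp dL oe Lv) /form -scalemxAl.
  rewrite !dotZl !dotDr !dotZr; rewrite /form in E1 E2; rewrite E1 E2; ring.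
exists ((enorm x1)^-1 *: x1), ((enorm x2)^-1 *: x2); split.
- exact: memvZ.
- exact: memvZ.
- by split; rewrite ?nrm// dotZl dotZr x12 !mulr0.
- by move=> v; exact: ext.
- by move=> v; exact: ext.
Qed.

(** Without existence, [principal_curvatures] would be its default value (0, 0) and say nothing
    about the form. *)
Lemma eigenvalues_exist A L e1 e2 : \dim L = 2%N -> onb L e1 e2 ->
  form A e1 e2 = form A e2 e1 -> exists l, is_eigenvalues (form A) L l.
Proof.
move=> dL oe sA; have [L1 L2 [n1 n2 n12]] := oe.
have n21 : dot e2 e1 = 0 by rewrite dotC.
have nz e : dot e e = 1 -> e != 0.
  by move=> ne; apply/eqP => e0; move: ne; rewrite e0 dot0l => /esym/eqP; rewrite oner_eq0.
pose a := form A e1 e1; pose b := form A e1 e2; pose c := form A e2 e2.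
(* If b = 0, e1 and e2 are already eigenvectors, while the vectors [x l] below could vanish. *)
have [b0|b0] := eqVneq b 0.
  have h12 : form A e1 e2 = 0 by [].
  have h21 : form A e2 e1 = 0 by rewrite -sA.
  have [ac|/ltW ac] := leP a c.
    exists (a, c); apply: (is_eigenvalues_pair dL oe L1 L2) => //;
      by rewrite ?nz ?n1 ?n2 ?n12 ?n21 ?mulr1 ?mulr0.
  exists (c, a); apply: (is_eigenvalues_pair dL oe L2 L1) => //;
    by rewrite ?nz ?n1 ?n2 ?n12 ?n21 ?mulr1 ?mulr0.
(* The square root of the discriminant of the characteristic polynomial. *)
pose d := Num.sqrt ((a - c) ^+ 2 + 4 * b ^+ 2).
have d2 : d ^+ 2 = (a - c) ^+ 2 + 4 * b ^+ 2.
  by rewrite sqr_sqrtr// addr_ge0 ?sqr_ge0 // mulr_ge0 ?sqr_ge0.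
have d0 : 0 <= d by exact: sqrtr_ge0.
(* The eigenvector equation tested on e1 holds for every l; tested on e2 it is the characteristic
   equation. *)
pose x l := b *: e1 + (l - a) *: e2.
have xL l : x l \in L by rewrite memvD ?memvZ.
have x1 l : dot (x l) e1 = b by rewrite dotDl !dotZl n1 n21; ring.
have x2 l : dot (x l) e2 = l - a by rewrite dotDl !dotZl n12 n2; ring.
have x0 l : x l != 0.
  by apply: contraNneq b0 => xl; rewrite -(x1 l) xl dot0l.
have f1 l : form A (x l) e1 = b * a + (l - a) * b.
  by rewrite /form mulmxDl -!scalemxAl dotDl !dotZl /b sA.
have f2 l : form A (x l) e2 = b * b + (l - a) * c.
  by rewrite /form mulmxDl -!scalemxAl dotDl !dotZl.
exists ((a + c - d) / 2, (a + c + d) / 2).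
apply: (is_eigenvalues_pair dL oe (xL ((a + c - d) / 2)) (xL ((a + c + d) / 2))) => //.
- rewrite {2}/x dotDr !dotZr x1 x2.
  have dd : d * d = (a - c) ^+ 2 + 4 * b ^+ 2 by rewrite -expr2.
  by field: dd.
- by rewrite ler_pM2r ?invr_gt0// lerD2l; lra.
- by rewrite f1 x1; ring.
- rewrite f2 x2; have dd : d * d = (a - c) ^+ 2 + 4 * b ^+ 2 by rewrite -expr2.
  by field: dd.
- by rewrite f1 x1; ring.
- rewrite f2 x2; have dd : d * d = (a - c) ^+ 2 + 4 * b ^+ 2 by rewrite -expr2.
  by field: dd.
Qed.

Lemma principal_curvaturesP f p L A :
  second_form f p = form A -> (exists l, is_eigenvalues (form A) L l) ->
  is_eigenvalues (form A) L (principal_curvatures f p L).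
Proof.
move=> E [l0 H]; rewrite /principal_curvatures E.
by case: xgetP => [l _ //|/(_ l0)].
Qed.

(* A is the shape operator at the foot point and u *m (1 - s A)^-1 *m A, that
   is w *m A, the one at depth s. *)
Lemma form_parallel A (N u w : 'rV[R]_m) (s k : R) :
  0 < s -> 4 * k * s < 1 ->
  (forall v, enorm (v *m A) <= k * enorm v) ->
  (forall v, dot N (v *m A) = 0) ->
  (forall v v', dot N v = 0 -> dot N v' = 0 -> form A v v' = form A v' v) ->
  dot N u = 0 -> w - s *: (w *m A) = u ->
  form A u u + s / 2 * dot (w *m A) (w *m A) <= form A w u.
Proof.
move=> s0 ks bA tA sA Nu wu.
set z := w *m A.
have zN : dot N z = 0 by exact: tA.
have uA : u *m A = z - s *: (z *m A) by rewrite -wu mulmxBl -scalemxAl.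
have wE : w = u + s *: z by rewrite -wu subrK.
have E : form A w u = form A u u + s * form A u z.
  by rewrite {1}wE /form mulmxDl -scalemxAl dotDl dotZl -/(form A z u) sA.
rewrite E lerD2l -mulrA ler_pM2l// /form uA dotBl dotZl.
have : dot (z *m A) z <= k * dot z z.
  rewrite (le_trans (dot_ler _ _))// -sqr_enorm expr2 mulrA.
  by rewrite ler_wpM2r ?enorm_ge0.
move=> /(ler_wpM2l (ltW s0)); have := ler_wpM2r (dot_ge0 z) (ltW ks).
have := dot_ge0 z; move: (dot z z) (dot _ z) => c d; lra.
Qed.

End SecondForm.

Section ComplexLines.
Context {R : realType} {n : nat}.
Implicit Types (v w : 'rV[R]_(n + n)).

Lemma dot_row_mx (a b c d : 'rV[R]_n) :
  dot (row_mx a b) (row_mx c d) = dot a c + dot b d.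
Proof.
rewrite /dot big_split_ord /=; congr (_ + _); apply: eq_bigr => i _.
  by rewrite !row_mxEl.
by rewrite !row_mxEr.
Qed.

Lemma dot_Jmul v : dot (Jmul v) (Jmul v) = dot v v.
Proof.
rewrite -[in RHS](hsubmxK v) !dot_row_mx dotNl dotNr opprK.
by rewrite addrC.
Qed.

Lemma dot_Jmul_orth v : dot v (Jmul v) = 0.
Proof.
by rewrite -{1}(hsubmxK v) dot_row_mx dotNr (dotC (rsubmx v)) addNr.
Qed.

Lemma complex_line_onb (L : {vspace 'rV[R]_(n + n)}) : complex_line L ->
  exists e1 e2, onb L e1 e2.
Proof.
move=> [dL JL]; have v0 : vpick L != 0 by rewrite vpick0 -dimv_eq0 dL.
pose e := (enorm (vpick L))^-1 *: vpick L.
have Le : e \in L by rewrite memvZ ?memv_pick.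
have ne : dot e e = 1.
  rewrite dotZl dotZr -sqr_enorm mulrA -expr2 -exprMn mulVf ?expr1n//.
  by rewrite enorm_eq0.
exists e, (Jmul e); split=> //; first exact: JL.
by split; rewrite ?dot_Jmul ?dot_Jmul_orth.
Qed.

End ComplexLines.

(** * Strong pseudoconvexity of the inner domains *)

Lemma signed_dist_superlevel (R : realType) m (D : set 'rV[R]_m) (t : R) :
  open D -> D !=set0 -> ~` D !=set0 -> t < 0 ->
  [set x | signed_dist D x < t] = superlevel D (- t).
Proof.
move=> oD D0 D'0 t0; apply/seteqP; rewrite /superlevel /signed_dist -/(depth _ _).
split=> x /=; have [Dx|Dx] := pselect (D x).
- by rewrite edist0// sub0r ltrNl.
- rewrite /depth (@edist0 _ _ x (~` D))// subr0 => h.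
  by have := lt_trans (le_lt_trans (edist_ge0 x D) h) t0; rewrite ltxx.
- by rewrite edist0// sub0r ltrNl.
- rewrite /depth (@edist0 _ _ x (~` D))// .
  by rewrite oppr_lt0 => /(lt_trans t0); rewrite ltxx.
Qed.

Lemma bounded_set_compl (R : realType) m (D : set 'rV[R]_m) : (0 < m)%N ->
  bounded_set D -> ~` D !=set0.
Proof.
move=> m0 /bounded_set_enorm[M HM].
exists ((`|M| + 1) *: basis_vec (Ordinal m0)) => /HM.
rewrite enormZ enorm_basis mulr1 ger0_norm ?addr_ge0//.
by rewrite leNgt (le_lt_trans (ler_norm M))// ltrDl.
Qed.

Lemma dot_unit_normal (R : realType) m (f : 'rV[R]_m -> R) p v :
  grad f p != 0 -> dot (unit_normal f p) v = 0 <-> dot (grad f p) v = 0.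
Proof.
move=> g0; rewrite dotZl; split=> [/eqP|->]; last by rewrite mulr0.
by rewrite mulf_eq0 invr_eq0 enorm_eq0 (negPf g0) => /eqP.
Qed.

Lemma curvature_spectrum (R : realType) m (D V : set 'rV[R]_m) p f L e1 e2 :
  defining_near D p V f -> Ck_on 2 V f -> bd D p -> \dim L = 2%N ->
  onb L e1 e2 -> tangent_plane f p L ->
  is_eigenvalues (form (shape f p)) L (principal_curvatures f p L) /\
  sectional_mean f p L = form (shape f p) e1 e1 + form (shape f p) e2 e2.
Proof.
move=> df cf bp dL oe tL; have [oV Vp _ _ _] := df.
have [_ c1 c2] := Ck_on2P oV cf Vp; have [_ g0] := defining_near_bd df bp Vp.
have [L1 L2 _] := oe.
have H : is_eigenvalues (form (shape f p)) L (principal_curvatures f p L).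
  apply: principal_curvaturesP (second_formE c1 c2 g0) _.
  by apply: (eigenvalues_exist dL oe); apply: shape_sym => //; exact: tL.
by split=> //; rewrite (eigenvalues_trace dL H oe).
Qed.

(** The equality case: a and b are the values of the form at the foot point, a' and b' those at
    depth s, x and y the gains. *)
Lemma squeeze0 (R : realType) (a b a' b' x y : R) : a + x <= a' -> b + y <= b' ->
  0 <= x -> 0 <= y -> 0 <= a + b -> a' + b' <= 0 ->
  [/\ a + b = 0, x = 0 & y = 0].
Proof. by move=> *; split; lra. Qed.

Lemma superlevel_strongly_pseudoconvex (R : realType) n
    (D : set 'rV[R]_(n + n)) (k s : R) :
  open D -> ~` D !=set0 -> 0 < k -> (forall x, bd D x -> tame D k x) ->
  (forall p f L, complex_tangent D p f L -> 0 <= sectional_mean f p L) ->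
  (forall p f L, complex_tangent D p f L ->
     sectional_mean f p L = 0 -> sectional_gauss f p L <> 0) ->
  0 < s -> s < (4 * k)^-1 -> strongly_pseudoconvex (superlevel D s).
Proof.
move=> oD D' k0 tD hpsc hK s0 s1.
have bdE q := bd_superlevel oD D' k0 tD q s0 s1.
split=> [q /bdE qs|q f L [bq [V [df cf]] cL tL]].
  exists (tube D k), (fun x => s - depth D x); split.
    exact (level_defining oD D' k0 tD s0 s1 qs).
  exact (level_Ck2 oD D' k0 tD s).
have qs := (bdE q).1 bq.
have tq := tube_level s0 s1 qs; have bp := proj_bd oD D' (tube_sub oD D' tq).
have [U [g [cg Up dg]]] := chart_ex tD bp.
have [dL _] := cL; have [e1 [e2 oe]] := complex_line_onb cL.
have [Le1 Le2 _] := oe.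
have [oV Vq _ _ _] := df; have [_ gf] := defining_near_bd df bq Vq.
have [oU ckg NE /(_ _ Up)[gg bA]] := cg.
have LN u := level_normal oD D' k0 tD u s0 s1 qs df cf cg Up.
(* The normals at q and at its foot point coincide, so the same L is a complex tangent line of bd D
   there and both curvature hypotheses apply to it. *)
have tN u : u \in L -> dot (outer_normal D (proj D q)) u = 0.
  by move=> Lu; rewrite -(LN u).1; apply/dot_unit_normal => //; exact: tL.
have tLp : tangent_plane g (proj D q) L.
  by move=> u Lu; apply/dot_unit_normal => //; rewrite -NE// tN.
have ct : complex_tangent D (proj D q) g L.
  by split=> //; exists U.
have [_ Hq] := curvature_spectrum df cf bq dL oe tL.
have [spp Hp] := curvature_spectrum dg ckg bp dL oe tLp.
have [_ c1 c2] := Ck_on2P oU ckg Up.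
set A := shape g (proj D q) in bA spp Hp LN.
pose w (u : 'rV[R]_(n + n)) := u *m dproj D g q.
have ks : 4 * k * s < 1 by rewrite -qs; exact: tube_small k0 _ tq.
have ineq u : u \in L ->
    form A u u + s / 2 * dot (w u *m A) (w u *m A) <= form (shape f q) u u.
  move=> Lu; have [_ /(_ (tN u Lu))[E1 E2]] := LN u.
  rewrite [leRHS]/form E1 (mulmxA u _ A).
  apply: (form_parallel (N := grad g (proj D q)) s0 ks bA) => //.
  - by move=> v; rewrite dotC shape_tangent.
  - by move=> v v' gv gv'; apply: shape_sym.
  - exact: tLp.
have i1 := ineq _ Le1; have i2 := ineq _ Le2.
have q1 := dot_ge0 (w e1 *m A); have q2 := dot_ge0 (w e2 *m A).
have s2 : 0 < s / 2 by rewrite divr_gt0.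
have z1 := mulr_ge0 (ltW s2) q1; have z2 := mulr_ge0 (ltW s2) q2.
have mp := hpsc _ _ _ ct.
rewrite Hq ltNge; apply/negP => mq.
rewrite Hp in mp; have [m0 a1 a2] := squeeze0 i1 i2 z1 z2 mp mq.
rewrite -Hp in m0.
(* If A kills w, then u = w - s A w = w, so A kills u as well. *)
have kerA u : u \in L -> s / 2 * dot (w u *m A) (w u *m A) = 0 -> u *m A = 0.
  move=> Lu /eqP; rewrite mulf_eq0 (gt_eqF s2) /= dot_eq0 => /eqP wA.
  have [_ /(_ (tN u Lu))[_]] := LN u.
  by rewrite -/(w u) wA scaler0 subr0 => wu; rewrite -wu.
apply: (hK _ _ _ ct m0); apply: (eigenvalues_form0 spp) => v Lv.
rewrite (onb_decomp dL oe Lv) mulmxDl -!scalemxAl.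
by rewrite (kerA _ Le1 a1) (kerA _ Le2 a2) !scaler0 addr0.
Qed.

Theorem theorem3p1 (R : realType) (n : nat) (hn : (2 <= n)%N)
    (D : set 'rV[R]_(n + n)) (r : nat) (a : R)
    (hr : (2 <= r)%N) (ha0 : 0 < a) (ha1 : a <= 1)
    (hD : is_domain D) (hbounded : bounded_set D)
    (hbd : Cka_boundary r a D) (hpsc : pseudoconvex D)
    (hK : forall p f L, complex_tangent D p f L ->
       sectional_mean f p L = 0 -> sectional_gauss f p L <> 0) :
  exists2 t0 : R, t0 < 0 & forall t : R, t0 < t -> t < 0 ->
    is_domain [set x | signed_dist D x < t] /\
    strongly_pseudoconvex [set x | signed_dist D x < t].
Proof.
have [oD cD [x0 Dx0]] := hD; have [cbd hH] := hpsc.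
have D' : ~` D !=set0.
  by apply: bounded_set_compl hbounded; rewrite addn_gt0 (leq_trans _ hn).
have [k k0 tD] := tame_uniform oD hbounded cbd.
have d0 : 0 < depth D x0 by apply/(depth_gt0 oD D').
(* The first bound keeps the level set inside the tube; the second keeps x0 in D_t, for nonemptiness
   and as the common point in the connectedness argument. *)
pose d := Num.min (4 * k)^-1 (depth D x0).
exists (- d) => [|t td t0].
  by rewrite oppr_lt0 lt_min invr_gt0 mulr_gt0.
move: td; rewrite ltrNl lt_min => /andP[s1 sx0].
have s0 : 0 < - t by rewrite oppr_gt0.
rewrite signed_dist_superlevel//; last by exists x0.
split; last exact: (superlevel_strongly_pseudoconvex oD D' k0 tD hH hK s0 s1).
split.
- exact: superlevel_open.
- exact (superlevel_connected oD D' k0 tD cD s0 s1 sx0).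
- by exists x0.
Qed.
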